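(* There is an absolute constant $C>0$ such that the following holds. Let $\mathcal{G}=(G_1,\dots,G_T)$ be an always-connected temporal graph on $n\ge 2$ vertices whose underlying graph is outerplanar, and suppose $T\ge C\,n^{4/3}\log^{2.5}n$. Then a single agent starting at any given vertex can visit all vertices of $\mathcal{G}$ using only the snapshots $G_1,\dots,G_{\lceil Cn^{4/3}\log^{2.5}n\rceil}$.
   Context: A temporal graph $\mathcal{G}=(G_1,\dots,G_T)$ on a vertex set $V$ is a sequence of simple undirected graphs $G_t=(V,E_t)$. It is always-connected if each $G_t$ is connected. Its underlying graph is $(V,\bigcup_tE_t)$. A temporal walk is a sequence $((v_0,v_1),t_1),\dots,((v_{\ell-1},v_\ell),t_\ell)$ with $\{v_{j-1},v_j\}\in E_{t_j}$ and $t_1<\dots<t_\ell$. Waiting is allowed, and the walk visits $v_0,\dots,v_\ell$. *)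

(* Defs.v *)
From HB Require Import structures.
From mathcomp Require Export all_boot all_order all_algebra.
From mathcomp Require Export all_classical all_reals all_analysis.
Export Order.TTheory GRing.Theory Num.Theory.
Export numFieldNormedType.Exports.

Set Implicit Arguments.
Unset Strict Implicit.
Unset Printing Implicit Defensive.

Local Open Scope classical_set_scope.
Local Open Scope ring_scope.

Record sgraph (V : finType) := SGraph {
  adj : rel V;
  adj_sym : symmetric adj;
  adj_irr : irreflexive adj }.

Definition graph_connected (V : finType) (G : sgraph V) : Prop :=
  forall x y : V, connect (adj G) x y.

(* The snapshot G_t, t = 1, ..., T, is [G i] for the i : 'I_T with
   i.+1 = t. *)
Definition temporal_graph (V : finType) (T : nat) := 'I_T -> sgraph V.

Section TemporalGraph.
Variables (V : finType) (T : nat) (G : temporal_graph V T).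

Definition always_connected : Prop := forall i : 'I_T, graph_connected (G i).

Definition underlying_adj : rel V := fun x y => [exists i : 'I_T, adj (G i) x y].

Lemma underlying_adj_sym : symmetric underlying_adj.
Proof. by move=> x y; apply: eq_existsb => i; rewrite adj_sym. Qed.

Lemma underlying_adj_irr : irreflexive underlying_adj.
Proof. by move=> x; apply/existsP => -[i]; rewrite adj_irr. Qed.

Definition underlying : sgraph V := SGraph underlying_adj_sym underlying_adj_irr.

(* A step ((u, v), i) crosses the edge uv, from u to v, in the snapshot [G i]. *)
Definition step := ((V * V) * 'I_T)%type.

Definition follows (a b : step) : bool := (a.1.2 == b.1.1) && (a.2 < b.2)%N.

Definition temporal_walk (s : V) (w : seq step) : bool :=
  [&& all (fun a : step => adj (G a.2) a.1.1 a.1.2) w,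
      sorted follows w
    & if w is a :: _ then a.1.1 == s else true].

Definition visited (s : V) (w : seq step) : seq V :=
  s :: [seq a.1.2 | a : step <- w].

End TemporalGraph.

Section Outerplanar.
Variables (R : realType) (V : finType) (G : sgraph V).

Definition is_arc (A : set (R * R)) (p q : R * R) : Prop :=
  exists f : R -> R * R,
    [/\ {within `[0, 1], continuous f}, set_inj `[0, 1] f,
        f 0 = p, f 1 = q & A = f @` `[0, 1]].

Record plane_drawing := PlaneDrawing {
  point : V -> R * R;
  arc : V -> V -> set (R * R);
  point_inj : injective point;
  arcC : forall x y, adj G x y -> arc x y = arc y x;
  arcP : forall x y, adj G x y -> is_arc (arc x y) (point x) (point y);
  arc_point : forall x y z, adj G x y -> arc x y (point z) -> z = x \/ z = y;
  arc_meet : forall x y z w, adj G x y -> adj G z w ->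
    [set x; y] <> [set z; w] ->
    arc x y `&` arc z w `<=` point @` ([set x; y] `&` [set z; w]) }.

Definition drawn (D : plane_drawing) : set (R * R) :=
  range (point D) `|` [set p | exists x y, adj G x y /\ arc D x y p].

(* As [drawn D] is compact, its complement has exactly one unbounded connected
   component, which is therefore the whole of this set. *)
Definition outer_face (D : plane_drawing) : set (R * R) :=
  [set p | (~` drawn D) p /\
           ~ bounded_set (connected_component (~` drawn D) p)].

(* Vertices lie outside every face, so membership in the closure of the outer
   face means membership in its boundary. *)
Definition outerplanar : Prop :=
  exists D : plane_drawing, forall x : V, closure (outer_face D) (point D x).

End Outerplanar.

(* C n^(4/3) (log n)^(5/2), with the natural logarithm. *)
Definition exploration_bound (R : realType) (C : R) (n : nat) : R :=
  C * n%:R `^ (4%:R / 3%:R) * (ln n%:R) `^ (5%:R / 2%:R).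

(* Main.v *)
(* By a mod 2 count of crossings, an outerplanar graph has no K4 minor (a vertex
   placed in the outer face would turn it into a drawing of K5), so vertices of
   degree at most 2 can be eliminated one by one.  The resulting tree gives
   balanced separators of size 3, hence a division of every vertex set [C] into
   few much smaller pieces with boundaries of logarithmic size.

   If [B] separates [C] from the rest, then in any time window a little longer
   than [2 |C|] every [c] in [C] can both reach and be reached from some [p] in
   [B] without leaving [C :|: B].  By pigeonhole, an agent waiting at a suitable
   [p] can within a few such windows go to [c], stay there for a while and come
   back to [p].  Recursively, with [c] on the boundary of a piece of [C] and the
   stay used for excursions into that piece, the total time on [i] scales
   1 < x < x^2 < ... < x^i, where x is about n^(1/i), is n^(1 + 1/i) up to
   powers of log n; four scales are more than enough. *)

Require Import Defs.
From mathcomp Require Import zify ring lra.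

Set Implicit Arguments.
Unset Strict Implicit.
Unset Printing Implicit Defensive.

Section FiniteGraphs.
(* [classical_sets], exported by [Defs], hides many lemmas of these files. *)
Import mathcomp.boot.fintype mathcomp.boot.finset.

Section Minors.
Variables (V : finType) (H : rel V).
Implicit Types A B W : {set V}.

Definition induced A : rel V := [rel x y | [&& x \in A, y \in A & H x y]].

Definition connected_in A : Prop :=
  {in A &, forall x y, connect (induced A) x y}.

Definition linked A B : Prop := exists x y, [/\ x \in A, y \in B & H x y].

Definition complete_minor n W : Prop :=
  exists A : 'I_n -> {set V},
    [/\ forall i, A i \subset W, forall i, A i != set0,
        forall i, connected_in (A i),
        forall i j, i != j -> [disjoint A i & A j]
      & forall i j : 'I_n, i < j -> linked (A i) (A j)].

Lemma connect_inducedS A B x y :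
  A \subset B -> connect (induced A) x y -> connect (induced B) x y.
Proof.
move=> /subsetP AB; apply: connect_sub => {}x {}y /and3P[xA yA xy].
by apply: connect1; rewrite /induced /= !AB.
Qed.

Lemma connected_in_linked A B :
  connected_in A -> connected_in B -> linked A B ->
  {in A & B, forall x y, connect (induced (A :|: B)) x y}.
Proof.
move=> cA cB [a [b [aA bB ab]]] x y xA yB.
apply: connect_trans (connect_inducedS (subsetUl A B) (cA x a xA aA)) _.
apply: connect_trans (connect_inducedS (subsetUr A B) (cB b y bB yB)).
by apply: connect1; rewrite /induced /= !inE aA bB orbT.
Qed.

Hypothesis H_sym : symmetric H.

Lemma induced_sym A : symmetric (induced A).
Proof. by move=> x y; rewrite /induced /= H_sym andbCA. Qed.

Lemma linkedC A B : linked A B -> linked B A.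
Proof. by move=> [x [y [xA yB xy]]]; exists y, x; rewrite H_sym. Qed.

End Minors.

Section Contraction.
Variables (V V' : finType) (H : rel V) (H' : rel V').
Variables (W : {set V}) (W' : {set V'}) (f : V -> V').
Hypothesis f_onto : {in W', forall x, exists2 u, u \in W & f u = x}.
Hypothesis f_fibre : {in W', forall x, connected_in H (W :&: f @^-1: [set x])}.
Hypothesis f_edge : {in W' &, forall x y, H' x y ->
  linked H (W :&: f @^-1: [set x]) (W :&: f @^-1: [set y])}.

Lemma connected_in_preimset (A : {set V'}) :
  A \subset W' -> connected_in H' A -> connected_in H (W :&: f @^-1: A).
Proof.
move=> /subsetP AW' cA.
have fibreS x : x \in A -> W :&: f @^-1: [set x] \subset W :&: f @^-1: A.
  by move=> xA; rewrite setIS // preimsetS // sub1set.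
suff lift x y : x \in A -> connect (induced H' A) x y -> forall u v,
    u \in W :&: f @^-1: [set x] -> v \in W :&: f @^-1: [set y] ->
    connect (induced H (W :&: f @^-1: A)) u v.
  move=> u v /setIP[uW]; rewrite inE => fuA /setIP[vW]; rewrite inE => fvA.
  by apply: (lift (f u) (f v)); rewrite ?inE ?uW ?vW ?eqxx //; apply: cA.
move=> xA /connectP[p]; elim: p x xA => [|z p IH] x xA /=.
  move=> _ -> u v ux vx; apply: connect_inducedS (fibreS x xA) _.
  by apply: f_fibre => //; apply: AW'.
move=> /andP[/and3P[_ zA xz] pp] ey u v ux vy.
have [a [b [ax bz ab]]] := f_edge (AW' _ xA) (AW' _ zA) xz.
apply: (connect_trans (y := b)); last exact: IH zA pp ey _ _ bz vy.
apply: (connect_trans (y := a)).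
  by apply: connect_inducedS (fibreS x xA) _; apply: f_fibre => //; apply: AW'.
apply: connect1; rewrite /induced /= ab andbT.
by rewrite (subsetP (fibreS x xA)) ?(subsetP (fibreS z zA)).
Qed.

Lemma complete_minor_contraction n :
  complete_minor H' n W' -> complete_minor H n W.
Proof.
move=> [A [AW' A0 cA dA lA]]; exists (fun i => W :&: f @^-1: A i); split.
- by move=> i; apply: subsetIl.
- move=> i; have /set0Pn[x xA] := A0 i.
  have [u uW fu] := f_onto (subsetP (AW' i) x xA).
  by apply/set0Pn; exists u; rewrite !inE uW fu.
- by move=> i; apply: connected_in_preimset.
- move=> i j ij; rewrite -setI_eq0; apply/eqP/setP => u; rewrite !inE.
  by case: (boolP (f u \in A i)) => [/(disjointFr (dA i j ij))->|_];
    rewrite !andbF.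
- move=> i j ij; have [x [y [xi yj xy]]] := lA i j ij.
  have [u [v [ux vy uv]]] :=
    f_edge (subsetP (AW' i) x xi) (subsetP (AW' j) y yj) xy.
  exists u, v; split=> //; [move: ux|move: vy]; apply: subsetP;
    by rewrite setIS // preimsetS // sub1set.
Qed.

End Contraction.

Section Elimination.
Variables (V : finType) (H : rel V).
Hypotheses (H_sym : symmetric H) (H_irr : irreflexive H).

Definition neighbours (W : {set V}) v : {set V} := [set u in W | H v u].

Definition eliminate v : rel V :=
  [rel x y | H x y || [&& x != y, H v x & H v y]].

Lemma eliminate_sym v : symmetric (eliminate v).
Proof. by move=> x y; rewrite /eliminate /= H_sym eq_sym [H v x && _]andbC. Qed.

Lemma eliminate_irr v : irreflexive (eliminate v).
Proof. by move=> x; rewrite /eliminate /= H_irr eqxx. Qed.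

Lemma eliminate_degree2_edge (W : {set V}) v : #|neighbours W v| <= 2 ->
  exists2 a, a != v -> H v a & {in W :\ v &, forall x y, eliminate v x y ->
    H x y \/ ((x = a /\ H v y) \/ (y = a /\ H v x))}.
Proof.
move=> degv; case: (set_0Vmem (neighbours W v)) => [N0|[a]].
  exists v => [|x y]; first by rewrite eqxx.
  rewrite !inE => /andP[_ xW] _ /orP[|/and3P[_ vx _]]; first by left.
  by have : x \in neighbours W v; [rewrite inE xW|rewrite N0 inE].
rewrite inE => /andP[aW va]; exists a => // x y.
rewrite !inE => /andP[_ xW] /andP[_ yW].
case/orP => [|/and3P[xy vx vy]]; first by left.
right; case: (eqVneq x a) => [->|xa]; first by left.
case: (eqVneq y a) => [->|ya]; first by right.
have : [set a; x; y] \subset neighbours W v.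
  by rewrite !subUset !sub1set !inE aW va xW vx yW.
move/subset_leq_card; rewrite -setUA cardsU1 cards2 !inE negb_or xy.
by rewrite ![a == _]eq_sym xa ya => /leq_trans/(_ degv).
Qed.

(* Eliminating a vertex of degree at most 2 amounts to contracting one of its
   edges, or to deleting it when it is isolated. *)
Lemma eliminate_complete_minor (W : {set V}) v n :
  v \in W -> #|neighbours W v| <= 2 ->
  complete_minor (eliminate v) n (W :\ v) -> complete_minor H n W.
Proof.
move=> vW /eliminate_degree2_edge[a va aP].
pose f x := if x == v then a else x.
have fE x : x != v -> f x = x by rewrite /f => /negbTE->.
have in_fibre x : x \in W :\ v -> x \in W :&: f @^-1: [set x].
  by rewrite !inE => /andP[xv ->]; rewrite fE /=.
have v_fibre : v \in W :&: f @^-1: [set a] by rewrite !inE vW /f !eqxx.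
apply: (@complete_minor_contraction _ _ _ _ _ _ f) => x.
- by rewrite !inE => /andP[xv xW]; exists x; rewrite ?fE.
- rewrite in_setD1 => /andP[xv xW] u w ux wx.
  case: (eqVneq u w) => [->|uw]; first exact: connect0.
  apply: connect1; rewrite /induced /= ux wx /=.
  move: ux wx; rewrite !inE /f => /andP[_ /eqP ux] /andP[_ /eqP wx].
  case: (eqVneq u v) ux uw => [-> ax|_ ux];
    case: (eqVneq w v) wx => [-> ax'|_ wx] uw.
  + by [].
  + by rewrite wx -ax va // ax.
  + by rewrite H_sym ux -ax' va // ax'.
  + by rewrite ux wx eqxx in uw.
- move=> y xW' yW' /(aP x y xW' yW')[xy|[[-> vy]|[-> vx]]].
  + by exists x, y; rewrite !in_fibre.
  + by exists v, y; rewrite v_fibre in_fibre.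
  + by exists x, v; rewrite v_fibre in_fibre // H_sym.
Qed.

End Elimination.

Section Paths.
Variables (V : finType) (H : rel V) (W : {set V}).
Hypothesis H_sym : symmetric H.
Implicit Types s : seq V.

Definition path_in s : bool := [&& uniq s, all (mem W) s & sorted H s].

Definition segment s a b : {set V} := [set x in s | a <= index x s < b].

Lemma mem_segment s a b d i :
  uniq s -> i < size s -> (nth d s i \in segment s a b) = (a <= i < b).
Proof. by move=> us ltis; rewrite inE mem_nth //= index_uniq. Qed.

Lemma connected_in_segment s a b :
  uniq s -> sorted H s -> connected_in H (segment s a b).
Proof.
move=> us ps x y; rewrite [x \in _]inE [y \in _]inE.
move=> /andP[xs /andP[ax xb]] /andP[ys /andP[ay yb]].
suff up m n : a <= m -> m <= n -> n < b -> n < size s ->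
    connect (induced H (segment s a b)) (nth x s m) (nth x s n).
  case: (leqP (index x s) (index y s)) => [xy|/ltnW yx].
    by have := up _ _ ax xy yb; rewrite index_mem !nth_index // => ->.
  rewrite (sym_connect_sym (induced_sym H_sym _)).
  by have := up _ _ ay yx xb; rewrite index_mem !nth_index // => ->.
move=> am; elim: n => [|n IH] mn nb ns.
  by move: mn; rewrite leqn0 => /eqP->; apply: connect0.
move: mn; rewrite leq_eqVlt => /predU1P[->|mn]; first exact: connect0.
apply: connect_trans (IH mn (ltnW nb) (ltnW ns)) (connect1 _).
rewrite /induced /= !mem_segment ?(ltnW ns) // (sortedP x ps) // andbT.
by clear -am mn nb; lia.
Qed.

Lemma segments_complete_minor n d s (cuts : seq nat) (cut := nth 0 cuts) :
  path_in s -> sorted ltn cuts -> size cuts = n.+1 -> cut n <= size s ->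
  (forall i j, i.+1 < j < n -> exists a b,
     [/\ cut i <= a < cut i.+1, cut j <= b < cut j.+1
       & H (nth d s a) (nth d s b)]) ->
  complete_minor H n W.
Proof.
move=> /and3P[us /allP sW ps] sorted_cuts szcuts cutn chord.
have cut_lt i j : i < j <= n -> cut i < cut j.
  move=> /andP[ij jn]; apply: (sorted_ltn_nth ltn_trans) => //.
    by rewrite inE szcuts ltnS (leq_trans (ltnW ij)).
  by rewrite inE szcuts ltnS.
have cut_le i j : i <= j <= n -> cut i <= cut j.
  case/andP; rewrite leq_eqVlt => /predU1P[->//|ij jn].
  by rewrite ltnW ?cut_lt ?ij.
have in_piece i a : i < n -> cut i <= a < cut i.+1 ->
    nth d s a \in segment s (cut i) (cut i.+1).
  move=> ltin ha; rewrite mem_segment //; have := cut_le i.+1 n.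
  by rewrite ltin leqnn => /(_ isT); clear -ha cutn; lia.
exists (fun i : 'I_n => segment s (cut i) (cut i.+1)); split.
- by move=> i; apply/subsetP => x; rewrite inE => /andP[/sW].
- move=> i; apply/set0Pn; exists (nth d s (cut i)).
  by apply: in_piece; rewrite ?leqnn ?cut_lt ?ltnSn /=.
- by move=> i; apply: connected_in_segment.
- have disj i j : i < j < n ->
      [disjoint segment s (cut i) (cut i.+1) & segment s (cut j) (cut j.+1)].
    move=> ijn; have ij : cut i.+1 <= cut j by apply: cut_le; clear -ijn; lia.
    rewrite -setI_eq0; apply/eqP/setP => x; rewrite !inE.
    apply/negP => /andP[/andP[_ xi] /andP[_ xj]].
    by clear -xi xj ij; lia.
  move=> i j; rewrite neq_ltn => /orP[] ij; last rewrite disjoint_sym;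
    by apply: disj; rewrite ij ltn_ord.
- move=> i j; rewrite leq_eqVlt => /predU1P[ij|ij]; last first.
    have [|a [b [ha hb ab]]] := chord i j; first by rewrite ij ltn_ord.
    by exists (nth d s a), (nth d s b); split=> //; apply: in_piece.
  have lt_i : cut i < cut j by rewrite -ij cut_lt ?ltnSn /=.
  have lt_j : cut j < cut j.+1 by rewrite cut_lt ?ltnSn /=.
  exists (nth d s (cut j).-1), (nth d s (cut j)); split.
  + by apply: in_piece => //; rewrite ij; clear -lt_i; lia.
  + by apply: in_piece => //; rewrite leqnn.
  + rewrite -{2}(ltn_predK lt_i); apply: (sortedP d ps).
    rewrite (ltn_predK lt_i); apply: leq_trans lt_j (leq_trans _ cutn).
    by rewrite cut_le // ltn_ord /=.
Qed.

Definition flip i s : seq V := rev (take i s) ++ drop i s.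

Lemma perm_flip i s : perm_eq (flip i s) s.
Proof.
by rewrite -[X in perm_eq _ X](cat_take_drop i s) perm_cat2r perm_rev.
Qed.

Lemma nth_flip d s i j : i <= size s ->
  nth d (flip i s) j = nth d s (if j < i then i - j.+1 else j).
Proof.
move=> ltis; have szt : size (take i s) = i by rewrite size_takel.
rewrite nth_cat size_rev szt; case: (ltnP j i) => ij; last first.
  by rewrite nth_drop subnKC.
by rewrite nth_rev szt // nth_take //; clear -ij; lia.
Qed.

Lemma path_in_flip d s i :
  path_in s -> 0 < i < size s -> H (nth d s 0) (nth d s i) ->
  path_in (flip i s).
Proof.
move=> /and3P[us sW ps] /andP[i0 ltis] chord.
have flip_s := perm_flip i s.
rewrite /path_in (perm_uniq flip_s) us (perm_all _ flip_s) sW /=.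
apply/(sortedP d) => j; rewrite (perm_size flip_s) => ltjs.
rewrite !nth_flip ?(ltnW ltis) //; have [ltji|ltij|eji] := ltngtP j.+1 i.
- rewrite H_sym -(subnSK ltji); apply: (sortedP d ps).
  by clear -ltji ltis; lia.
- exact: (sortedP d ps).
- by rewrite eji subnn.
Qed.

Definition longest_path s : Prop :=
  path_in s /\ forall s', path_in s' -> size s' <= size s.

Lemma ex_longest_path : exists s, longest_path s.
Proof.
pose P n := `[< exists2 s, path_in s & size s = n >].
have P0 : exists n, P n by exists 0; apply/asboolP; exists [::].
have P_le n : P n -> n <= #|V|.
  by move=> /asboolP[s /and3P[us _ _] <-]; rewrite -(card_uniqP us) max_card.
case: (ex_maxnP P0 P_le) => n /asboolP[s sP <-] n_max.
exists s; split=> // s' s'P.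
by apply: n_max; apply/asboolP; exists s'.
Qed.

Lemma longest_path_flip d s i :
  longest_path s -> 0 < i < size s -> H (nth d s 0) (nth d s i) ->
  longest_path (flip i s).
Proof.
move=> [sP s_max] ltis chord; split; first exact: path_in_flip chord.
by move=> s' /s_max; rewrite (perm_size (perm_flip i s)).
Qed.

Lemma longest_path_gt0 s : W != set0 -> longest_path s -> 0 < size s.
Proof.
move=> /set0Pn[x xW] [_ s_max]; apply: (s_max [:: x]).
by rewrite /path_in /= xW.
Qed.

Lemma longest_path_neighbour d s u :
  longest_path s -> u \in W -> H (nth d s 0) u -> u \in s.
Proof.
move=> [/and3P[us sW ps] s_max] uW hu; apply/negPn/negP => uNs.
suff /s_max : path_in (u :: s) by rewrite ltnn.
rewrite /path_in /= uNs us uW sW /=.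
by case: s ps hu {us sW s_max uNs} => //= x s ->; rewrite H_sym => ->.
Qed.

End Paths.

Section MinimumDegree.
Variables (V : finType) (H : rel V) (W : {set V}).
Hypotheses (H_sym : symmetric H) (H_irr : irreflexive H).
Hypothesis W_neq0 : W != set0.
Hypothesis W_deg : {in W, forall v, 2 < #|neighbours H W v|}.

Lemma ex_third_neighbour d s x y :
  longest_path H W s ->
  exists2 j, j < size s & [/\ nth d s j != x, nth d s j != y
                            & H (nth d s 0) (nth d s j)].
Proof.
move=> sL; have [/and3P[_ /allP sW _] _] := sL.
have /W_deg deg : nth d s 0 \in W.
  by apply/sW/mem_nth; apply: longest_path_gt0 sL.
have /set0Pn[u] : neighbours H W (nth d s 0) :\: [set x; y] != set0.
  rewrite setD_eq0; apply: contraTN deg => /subset_leq_card le2.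
  by rewrite -leqNgt (leq_trans le2) // cards2; case: (x != y).
rewrite !inE negb_or => /andP[/andP[ux uy] /andP[uW hu]].
have us := longest_path_neighbour H_sym sL uW hu.
by exists (index u s); rewrite ?index_mem // nth_index.
Qed.

(* Among the longest paths choose one whose first vertex [v0] has its second
   neighbour [vi] on the path as close as possible.  Flipping the part before
   [vi] gives a longest path starting at [v(i-1)].  By minimality a third
   neighbour of [v0], and one of [v(i-1)], lie beyond [vi]. *)
Lemma ex_longest_path_chords d : exists s i j l,
  [/\ path_in H W s, 1 < i, i < j < size s, i < l < size s
    & [/\ H (nth d s 0) (nth d s i), H (nth d s 0) (nth d s j)
        & H (nth d s i.-1) (nth d s l)]].
Proof.
pose P i := `[< exists s, [/\ longest_path H W s, 1 < i < size s
                            & H (nth d s 0) (nth d s i)] >].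
have chord s x : longest_path H W s ->
    exists j, [/\ 1 < j < size s, nth d s j != x & H (nth d s 0) (nth d s j)].
  move=> sL; have [j js [j1 jx hj]] :=
    ex_third_neighbour d (nth d s 1) x sL.
  exists j; split=> //; rewrite js andbT.
  by case: j {js jx} j1 hj => [|[|j]] //; rewrite ?eqxx // H_irr.
have exP : exists i, P i.
  have [s sL] := ex_longest_path H W; have [i [ltis _ hi]] := chord s d sL.
  by exists i; apply/asboolP; exists s.
case: (ex_minnP exP) => i /asboolP[s [sL /andP[i1 ltis] hi]] i_min.
have beyond s' : longest_path H W s' ->
    exists2 j, i < j < size s' & H (nth d s' 0) (nth d s' j).
  move=> s'L; have [j [/andP[j1 js] ji hj]] := chord s' (nth d s' i) s'L.
  exists j; rewrite // js andbT ltn_neqAle; apply/andP; split.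
    by apply: contraNneq ji => ->.
  by apply: i_min; apply/asboolP; exists s'; rewrite j1 js.
have i0 : 0 < i < size s by rewrite ltnW.
have [j ltij hj] := beyond s sL.
have [l] := beyond _ (longest_path_flip H_sym sL i0 hi).
rewrite (perm_size (perm_flip i s)) !nth_flip ?(ltnW ltis) //.
move=> /andP[il ls]; rewrite (ltnW i1) subn1 ltnNge (ltnW il) /= => hl.
by exists s, i, j, l; rewrite il ls; split=> //; case: sL.
Qed.

Lemma min_degree3_K4_minor : complete_minor H 4 W.
Proof.
have /set0Pn[d _] := W_neq0.
have [s [i [j [l [sP i1 /andP[ij js] /andP[il ls] [hi hj hl]]]]]] :=
  ex_longest_path_chords d.
apply: (@segments_complete_minor _ _ _ H_sym 4 d s
  [:: 0; i.-1; i; minn j l; size s]) => //=.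
- by clear -i1 ij js il ls; lia.
case=> [|[|a]] [|[|[|[|b]]]] //=; rewrite ?andbF // => _.
- by exists 0, i; split=> //; lia.
- by exists 0, j; split=> //; lia.
- by exists i.-1, l; split=> //; lia.
Qed.

End MinimumDegree.

Section EliminationTrees.
Variable V : finType.
Implicit Types (H : rel V) (W N : {set V}).

(* A rooted tree decomposition of width [k]: the bag of [v] consists of [v] and
   of the set [tree_up v] of at most [k] ancestors of [v]. *)
Record elimination_tree H W (k : nat) := EliminationTree {
  tree_root : V;
  tree_depth : V -> nat;
  tree_parent : V -> V;
  tree_up : V -> {set V};
  tree_root_in : tree_root \in W;
  tree_parent_root : tree_parent tree_root = tree_root;
  tree_up_root : tree_up tree_root = set0;
  tree_parent_in : {in W, forall v, v != tree_root -> tree_parent v \in W};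
  tree_depth_parent : {in W, forall v, v != tree_root ->
    tree_depth (tree_parent v) < tree_depth v};
  tree_up_parent : {in W, forall v, v != tree_root ->
    tree_up v \subset tree_parent v |: tree_up (tree_parent v)};
  card_tree_up : {in W, forall v, #|tree_up v| <= k};
  tree_edge : {in W &, forall u v, H u v ->
    u \in tree_up v \/ v \in tree_up u} }.

Definition clique H N : Prop := {in N &, forall x y, x != y -> H x y}.

Lemma clique_eliminate H W v : clique (eliminate H v) (neighbours H W v).
Proof.
move=> x y; rewrite !inE => /andP[_ vx] /andP[_ vy] xy.
by rewrite /eliminate /= xy vx vy orbT.
Qed.

Section Bags.
Variables (H : rel V) (W : {set V}) (k : nat) (T : elimination_tree H W k).

Lemma depth_tree_up u v :
  v \in W -> u \in tree_up T v -> tree_depth T u < tree_depth T v.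
Proof.
have [n] := ubnP (tree_depth T v).
elim: n v => // n IH v; rewrite ltnS => vn vW.
case: (eqVneq v (tree_root T)) => [->|vr]; first by rewrite tree_up_root inE.
have lt_par := tree_depth_parent vW vr.
move/(subsetP (tree_up_parent vW vr)) => /setU1P[->//|up].
apply: ltn_trans (lt_par); apply: IH up; first exact: leq_trans vn.
exact: tree_parent_in.
Qed.

Lemma clique_sub_bag N :
  N \subset W -> clique H N -> exists2 p, p \in W & N \subset p |: tree_up T p.
Proof.
move=> /subsetP NW cN; case: (set_0Vmem N) => [->|[a aN]].
  by exists (tree_root T); rewrite ?tree_root_in ?sub0set.
case: (arg_maxnP (tree_depth T) aN) => p pN p_max; exists p; first exact: NW.
apply/subsetP => u uN; case: (eqVneq u p) => [->|up]; first exact: setU11.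
have [|/(depth_tree_up (NW u uN))] :=
    tree_edge T (NW u uN) (NW p pN) (cN u p uN pN up); first exact: setU1r.
by rewrite ltnNge; move/negP; case; apply: p_max.
Qed.

End Bags.

Lemma elimination_tree_single H v k :
  irreflexive H -> inhabited (elimination_tree H [set v] k).
Proof.
move=> H_irr; constructor.
apply: (@EliminationTree _ _ _ v (fun=> 0) id (fun=> set0)) => //.
- exact: set11.
- by move=> x /set1P->; rewrite eqxx.
- by move=> x _ _; apply: sub0set.
- by move=> x _; rewrite cards0.
- by move=> x y /set1P-> /set1P->; rewrite H_irr.
Qed.

Lemma elimination_tree_extend H W v k :
  symmetric H -> irreflexive H -> v \in W -> #|neighbours H W v| <= k ->
  inhabited (elimination_tree (eliminate H v) (W :\ v) k) ->
  inhabited (elimination_tree H W k).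
Proof.
move=> H_sym H_irr vW degv [T]; constructor.
have NW : neighbours H W v \subset W :\ v.
  apply/subsetP => x; rewrite !inE => /andP[-> vx]; rewrite andbT.
  by apply: contraTneq vx => ->; rewrite H_irr.
have [p pW' Np] := cid2 (clique_sub_bag T NW (@clique_eliminate H W v)).
have not_v x : x \in W :\ v -> (x == v) = false.
  by rewrite !inE => /andP[/negbTE].
have inW' x : x \in W -> x != v -> x \in W :\ v.
  by move=> xW xv; rewrite !inE xv.
have inW x : x \in W :\ v -> x \in W by rewrite !inE => /andP[].
have [rW' rv] := (tree_root_in T, not_v _ (tree_root_in T)).
apply: (@EliminationTree _ _ _ (tree_root T)
  [eta tree_depth T with v |-> (\max_(y in W :\ v) tree_depth T y).+1]
  [eta tree_parent T with v |-> p] [eta tree_up T with v |-> neighbours H W v]);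
  rewrite /= ?rv ?tree_parent_root ?tree_up_root ?inW //= => x.
- move=> xW; case: (eqVneq x v) => [_ _|xv xr]; first exact: inW.
  exact/inW/tree_parent_in/xr/inW'.
- move=> xW; case: (eqVneq x v) => [_ _|xv xr].
    by rewrite not_v //= ltnS leq_bigmax_cond.
  by rewrite not_v ?tree_parent_in ?tree_depth_parent ?inW'.
- move=> xW; case: (eqVneq x v) => [_ _|xv xr]; first by rewrite not_v.
  by rewrite not_v ?tree_parent_in ?tree_up_parent ?inW'.
- by move=> xW; case: (eqVneq x v) => // xv; apply/card_tree_up/inW'.
- move=> y xW yW xy; case: (eqVneq y v) => [yv|yv].
    by left; rewrite inE xW H_sym -yv.
  case: (eqVneq x v) => [xv|xv]; first by right; rewrite inE yW -xv.
  apply: (tree_edge T (inW' x xW xv) (inW' y yW yv)).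
  by rewrite /eliminate /= xy.
Qed.

Lemma K4_free_elimination_tree H W :
  symmetric H -> irreflexive H -> W != set0 -> ~ complete_minor H 4 W ->
  inhabited (elimination_tree H W 2).
Proof.
have [n] := ubnP #|W|; elim: n H W => // n IH H W; rewrite ltnS.
move=> Wn sH iH W0 K4W.
have [v vW degv] : exists2 v, v \in W & #|neighbours H W v| <= 2.
  apply: contrapT => no_v; apply/K4W/min_degree3_K4_minor => // v vW.
  by rewrite ltnNge; apply/negP => degv; apply: no_v; exists v.
case: (eqVneq (W :\ v) set0) => W'0.
  by rewrite -(setD1K vW) W'0 setU0; apply: elimination_tree_single.
apply: (elimination_tree_extend _ _ vW degv) => //; apply: IH => //.
- by move: Wn; rewrite (cardsD1 v) vW.
- exact: eliminate_sym.
- exact: eliminate_irr.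
- by move=> K4; apply/K4W/(eliminate_complete_minor _ vW degv K4).
Qed.

End EliminationTrees.

Section Separators.
Variables (V : finType) (H : rel V).
Implicit Types B C S W X : {set V}.

Definition closed_off C B : Prop :=
  forall u w, u \in C -> H u w -> w \in C \/ w \in B.

Lemma closed_offT B : closed_off [set: V] B.
Proof. by move=> u w _ _; left; rewrite inE. Qed.

Lemma closed_offD X S : closed_off X S -> closed_off (X :\: S) S.
Proof.
move=> XS u w /setDP[uX _] uw; case: (boolP (w \in S)) => wS; first by right.
by left; rewrite inE wS; have [|/(negP wS)] := XS u w uX uw.
Qed.

Lemma closed_offC X S :
  symmetric H -> closed_off X S -> closed_off (~: X :\: S) S.
Proof.
move=> H_sym XS u w; rewrite !inE => /andP[uS uX] uw.
case: (boolP (w \in S)) => wS; [by right|left].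
apply/negP => wX; have [|] : u \in X \/ u \in S.
- by apply: XS wX _; rewrite H_sym.
- exact/negP.
- exact/negP.
Qed.

Lemma closed_offI C B X S :
  closed_off C B -> closed_off X S -> closed_off (C :&: X) (B :|: (S :&: C)).
Proof.
move=> CB XS u w /setIP[uC uX] uw; rewrite !inE.
have [wC|->] := CB u w uC uw; last by right.
by have [->|->] := XS u w uX uw; rewrite wC ?orbT; [left|right].
Qed.

Lemma ex_balanced_union (I : finType) (D : {set I}) (F : I -> {set V}) W :
  0 < #|W| -> {in D, forall i, 2 * #|W :&: F i| <= #|W|} ->
  #|W| <= 4 * #|W :&: \bigcup_(i in D) F i| ->
  exists2 Q : {set I}, Q \subset D &
    #|W| <= 4 * #|W :&: \bigcup_(i in Q) F i| <= 3 * #|W|.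
Proof.
move=> W0 light heavyD.
pose heavy (Q : {set I}) :=
  (Q \subset D) && (#|W| <= 4 * #|W :&: \bigcup_(i in Q) F i|).
have /minset_exists[Q /minsetP[/andP[QD heavyQ] Q_min] _] : heavy D.
  by rewrite /heavy subxx.
exists Q => //; rewrite heavyQ /=.
have /set0Pn[i iQ] : Q != set0.
  apply: contraTneq heavyQ => ->.
  by rewrite big_set0 setI0 cards0 muln0 -ltnNge.
have lightQ : 4 * #|W :&: \bigcup_(j in Q :\ i) F j| < #|W|.
  rewrite ltnNge; apply: contraTN isT => heavyQi.
  suff QiE : Q :\ i = Q by rewrite -QiE !inE eqxx in iQ.
  by apply: Q_min; rewrite /heavy ?subD1set // (subset_trans (subD1set _ _) QD).
rewrite (big_setD1 i) //= setIUr.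
have := light i (subsetP QD i iQ).
have := (leq_card_setU (W :&: F i) (W :&: \bigcup_(j in Q :\ i) F j)).1.
by clear -lightQ; lia.
Qed.

Section Subtrees.
Variables (k : nat) (T : elimination_tree H [set: V] k).

Definition subtree v : {set V} := [set u | fconnect (tree_parent T) u v].

Definition children v : {set V} :=
  [set c | (c != tree_root T) && (tree_parent T c == v)].

Lemma subtree_refl v : v \in subtree v.
Proof. by rewrite inE connect0. Qed.

Lemma subtree_trans u v w :
  u \in subtree v -> v \in subtree w -> u \in subtree w.
Proof. by rewrite !inE; apply: connect_trans. Qed.

Lemma parent_subtree u v : tree_parent T u \in subtree v -> u \in subtree v.
Proof. by rewrite !inE; apply: connect_trans; apply: fconnect1. Qed.

Lemma subtree_ind v (P : V -> Prop) :
  P v ->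
  (forall u, tree_parent T u \in subtree v -> P (tree_parent T u) -> P u) ->
  forall u, u \in subtree v -> P u.
Proof.
move=> Pv Pparent u; rewrite inE => /connectP[p].
elim: p u => [|x p IH] u /= => [_ <-//|/andP[/eqP<-] pp ep].
by apply: Pparent; [rewrite inE; apply/connectP; exists p|apply: IH].
Qed.

Lemma parent_ind (P : V -> Prop) :
  P (tree_root T) ->
  (forall u, u != tree_root T -> P (tree_parent T u) -> P u) ->
  forall u, P u.
Proof.
move=> Proot Pparent u; have [n] := ubnP (tree_depth T u).
elim: n u => // n IH u; rewrite ltnS => un.
case: (eqVneq u (tree_root T)) => [->//|ur]; apply: Pparent => //; apply: IH.
exact: leq_trans (tree_depth_parent _ ur) un.
Qed.

Lemma subtree_root : subtree (tree_root T) = [set: V].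
Proof.
apply/setP => u; rewrite [RHS]inE.
by elim/parent_ind: u => [|u _]; [apply: subtree_refl|apply: parent_subtree].
Qed.

Lemma tree_up_subtree u v : u \in tree_up T v -> v \in subtree u.
Proof.
elim/parent_ind: v => [|v vr IH]; first by rewrite tree_up_root inE.
move/(subsetP (tree_up_parent (in_setT v) vr)) => /setU1P[->|/IH];
  by [rewrite inE fconnect1|apply: parent_subtree].
Qed.

Lemma subtree_tree_up v u w :
  u \in subtree v -> w \in tree_up T u -> w \in subtree v \/ w \in tree_up T v.
Proof.
move=> uv; move: w; elim/subtree_ind: u / uv => [|u uv IH] w; first by right.
case: (eqVneq u (tree_root T)) => [->|ur]; first by rewrite tree_up_root inE.
by move/(subsetP (tree_up_parent (in_setT u) ur)) => /setU1P[->|/IH//]; left.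
Qed.

Lemma closed_off_subtree v : closed_off (subtree v) (tree_up T v).
Proof.
move=> u w uv uw.
have [/tree_up_subtree wu|] := tree_edge T (in_setT u) (in_setT w) uw.
  by left; apply: subtree_trans wu uv.
exact: subtree_tree_up.
Qed.

Lemma closed_off_child_subtrees v (Q : {set V}) : Q \subset children v ->
  closed_off (\bigcup_(c in Q) subtree c) (v |: tree_up T v).
Proof.
move=> /subsetP Qv u w /bigcupP[c cQ uc] uw.
have := Qv c cQ; rewrite inE => /andP[cr /eqP cv].
have [wc|wc] := closed_off_subtree uc uw.
  by left; apply/bigcupP; exists c.
by right; have := subsetP (tree_up_parent (in_setT c) cr) w wc; rewrite cv.
Qed.

Lemma subtreeE v : subtree v = v |: \bigcup_(c in children v) subtree c.
Proof.
apply/setP => u; apply/idP/setU1P => [uv|[->|/bigcupP[c]]]; last 2 first.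
- exact: subtree_refl.
- rewrite inE => /andP[_ /eqP cv] uc.
  by apply: subtree_trans uc (parent_subtree _); rewrite cv subtree_refl.
elim/subtree_ind: u / uv => [|u _]; first by left.
case: (eqVneq u (tree_root T)) => [->|ur]; first by rewrite tree_parent_root.
case=> [uv|/bigcupP[c cv uc]]; right; apply/bigcupP.
  by exists u; rewrite ?subtree_refl // inE ur uv eqxx.
by exists c => //; apply: parent_subtree.
Qed.

Lemma ex_lowest_heavy_vertex W : 0 < #|W| ->
  exists2 v, #|W| < 2 * #|W :&: subtree v| &
    {in children v, forall c, 2 * #|W :&: subtree c| <= #|W|}.
Proof.
move=> W0; pose heavy v := #|W| < 2 * #|W :&: subtree v|.
have heavy_root : heavy (tree_root T).
  by rewrite /heavy subtree_root setIT -subn_gt0 mul2n -addnn addnK.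
case: (arg_maxnP (tree_depth T) heavy_root) => v heavy_v v_max.
exists v => // c; rewrite inE => /andP[cr /eqP cv].
rewrite leqNgt; apply/negP => /v_max.
by rewrite /= leqNgt -cv tree_depth_parent.
Qed.

Lemma balanced_separator W : 1 < #|W| ->
  exists S X : {set V}, [/\ #|S| <= k.+1, closed_off X S,
    4 * #|W :&: X| <= 3 * #|W| & 4 * #|W :\: X| <= 3 * #|W|].
Proof.
move=> W1; have W0 := ltnW W1.
have [v heavy light] := ex_lowest_heavy_vertex W0.
have heavy_children : #|W| <= 4 * #|W :&: \bigcup_(c in children v) subtree c|.
  move: heavy; rewrite subtreeE setIUr; set below := W :&: \bigcup_(c in _) _.
  have := (leq_card_setU (W :&: [set v]) below).1.
  have := subset_leq_card (subsetIr W [set v]); rewrite cards1.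
  by clear -W1; lia.
have [Q Qv /andP[Q_ge Q_le]] := ex_balanced_union W0 light heavy_children.
exists (v |: tree_up T v), (\bigcup_(c in Q) subtree c); split=> //.
- rewrite cardsU1 -add1n; apply: leq_add; first exact: leq_b1.
  exact/card_tree_up/in_setT.
- exact: closed_off_child_subtrees.
- by have := cardsID (\bigcup_(c in Q) subtree c) W; clear -Q_ge; lia.
Qed.

End Subtrees.
End Separators.

Section Divisions.
Variables (V : finType) (H : rel V).
Implicit Types (A B C : {set V}) (p : {set V} * {set V}).
Implicit Types ps : seq ({set V} * {set V}).

Definition covers ps C : Prop :=
  {in C, forall x, exists2 p, p \in ps & x \in p.1}.

Definition piece (m b : nat) p : Prop :=
  (exists c, p = ([set c], [set c])) \/
  [/\ closed_off H p.1 p.2, p.2 != set0, #|p.1| <= m & #|p.2| <= b].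

(* The elements of [ps] are pairs of a piece and its boundary. *)
Definition division (m b : nat) C B ps : Prop :=
  [/\ {in ps, forall p, p.2 \subset C :|: B}, {in ps, forall p, piece m b p}
    & covers ps C].

Definition singletons A : seq ({set V} * {set V}) :=
  [seq ([set c], [set c]) | c <- enum A].

Lemma division_singletons m b A B : division m b A B (singletons A).
Proof.
split.
- by move=> p /mapP[c]; rewrite mem_enum => cA ->; rewrite sub1set inE cA.
- by move=> p /mapP[c _ ->]; left; exists c.
- move=> c cA; exists ([set c], [set c]); last exact: set11.
  by apply/mapP; exists c; rewrite ?mem_enum.
Qed.

Lemma ex_division_small m b c C B :
  closed_off H C B -> B != set0 -> #|C| <= m ->
  exists2 ps, division m (#|B| + b) C B ps & size ps * m <= m + c.
Proof.
move=> CB B0 Cm; exists [:: (C, B)]; last by rewrite mul1n leq_addr.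
split.
- by move=> p /[!inE] /eqP->; apply: subsetUr.
- by move=> p /[!inE] /eqP->; right; split; rewrite ?leq_addr.
- by move=> x xC; exists (C, B); rewrite ?inE.
Qed.

Lemma division_le m b b' C B ps :
  b <= b' -> division m b C B ps -> division m b' C B ps.
Proof.
move=> bb' [psB psP psC]; split=> // p /psP[|[? ? ? pb]]; first by left.
by right; split=> //; apply: leq_trans bb'.
Qed.

Lemma division_cat m b C B C1 B1 C2 B2 ps1 ps2 :
  C \subset C1 :|: C2 ->
  C1 :|: B1 \subset C :|: B -> C2 :|: B2 \subset C :|: B ->
  division m b C1 B1 ps1 -> division m b C2 B2 ps2 ->
  division m b C B (ps1 ++ ps2).
Proof.
move=> C12 CB1 CB2 [psB1 psP1 psC1] [psB2 psP2 psC2]; split.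
- move=> p; rewrite mem_cat => /orP[/psB1 h|/psB2 h].
    exact: subset_trans h CB1.
  exact: subset_trans h CB2.
- by move=> p; rewrite mem_cat => /orP[/psP1|/psP2].
- move=> x /(subsetP C12) /setUP[/psC1|/psC2] [p pp xp];
    by exists p => //; rewrite mem_cat pp ?orbT.
Qed.

Lemma division_cut m b C B X S (B' := B :|: (S :&: C)) ps1 ps2 :
  division m b (C :&: (X :\: S)) B' ps1 ->
  division m b (C :&: (~: X :\: S)) B' ps2 ->
  division m b C B (ps1 ++ (ps2 ++ singletons (S :&: C))).
Proof.
move=> div1 div2.
have sub (Y : {set V}) : Y \subset C -> Y :|: B' \subset C :|: B.
  move=> YC; rewrite !subUset subsetUr !(subset_trans _ (subsetUl C B)) //.
  exact: subsetIr.
apply: (division_cat _ _ _ div1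
    (division_cat (B := B') (subxx _) _ _ div2 (division_singletons m b _ B'))).
- apply/subsetP => x xC; rewrite !inE xC !andbT /=.
  by case: (x \in S); case: (x \in X).
- by rewrite sub ?subsetIl.
- by rewrite sub // subUset subsetIl subsetIr.
- by rewrite setSU ?subsetUl.
- by rewrite setSU ?subsetUr.
Qed.

Lemma ex_division k (m h : nat) C B :
  symmetric H -> elimination_tree H [set: V] k -> 0 < m ->
  closed_off H C B -> B != set0 -> 3 ^ h * #|C| <= 4 ^ h * m ->
  exists2 ps, division m (#|B| + k.+1 * h) C B ps &
    size ps * m <= m + k.+2 * h * #|C|.
Proof.
move=> H_sym T m0; elim: h C B => [|h IH] C B CB B0 hC.
  by apply: ex_division_small; move: hC; rewrite ?expn0 ?mul1n.
have [Cm|mC] := leqP #|C| m; first exact: ex_division_small.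
have [S [X [Sk XS CX]]] := balanced_separator T (leq_ltn_trans m0 mC).
rewrite [C :\: X]setDE => CXC.
pose B' := B :|: (S :&: C).
have B'0 : B' != set0.
  by apply: contraNneq B0 => B'0; rewrite -subset0 -B'0 subsetUl.
have B'k : #|B'| + k.+1 * h <= #|B| + k.+1 * h.+1.
  have := (leq_card_setU B (S :&: C)).1; have := subset_leq_card (subsetIl S C).
  by rewrite -/B' mulnS; clear -Sk; lia.
have divide (Y : {set V}) :
    closed_off H (Y :\: S) S -> 4 * #|C :&: Y| <= 3 * #|C| ->
    exists2 ps, division m (#|B| + k.+1 * h.+1) (C :&: (Y :\: S)) B' ps &
      size ps * m <= m + k.+2 * h * #|C :&: (Y :\: S)|.
  move=> YS CY; have [|ps /(division_le B'k) div ps_le] :=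
      IH _ B' (closed_offI CB YS) B'0; last by exists ps.
  have := subset_leq_card (setIS C (subsetDl Y S)).
  by move: hC CY; rewrite !expnS; clear; nia.
have [ps1 div1 sz1] := divide X (closed_offD XS) CX.
have [ps2 div2 sz2] := divide (~: X) (closed_offC H_sym XS) CXC.
exists (ps1 ++ (ps2 ++ singletons (S :&: C))).
  exact: division_cut div1 div2.
have szS : size (singletons (S :&: C)) <= k.+1.
  rewrite size_map -cardE; apply: leq_trans Sk.
  exact/subset_leq_card/subsetIl.
have CXX : #|C :&: (X :\: S)| + #|C :&: (~: X :\: S)| <= #|C|.
  rewrite -(cardsID X C) [C :\: X]setDE.
  by apply: leq_add; apply/subset_leq_card/setIS/subsetDl.
have hCXX := leq_mul (leqnn (k.+2 * h)) CXX.
have mS := leq_mul szS (leqnn m); have mk := leq_mul (leqnn k.+2) (ltnW mC).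
rewrite !size_cat [k.+2 * h.+1]mulnS; move: (k.+2 * h) sz1 sz2 hCXX mS mk => q.
by clear; lia.
Qed.

End Divisions.

Section Pigeonhole.

Lemma leq_card_cover (T : finType) (I : eqType) (F : I -> {set T}) (s : seq I)
    (U : {set T}) :
  {in U, forall x, exists2 i, i \in s & x \in F i} ->
  #|U| <= \sum_(i <- s) #|U :&: F i|.
Proof.
elim: s U => [|i s IH] U cov.
  rewrite big_nil leqn0 cards_eq0; apply: contraT => /set0Pn[x /cov[i]].
  by rewrite in_nil.
rewrite big_cons -(cardsID (F i) U) leq_add2l.
apply: leq_trans (IH (U :\: F i) _) _.
  move=> x /setDP[/cov[j /predU1P[->|js] xj] xi]; last by exists j.
  by rewrite xj in xi.
by apply: leq_sum => j _; apply/subset_leq_card/setSI/subsetDl.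
Qed.

Lemma ex_large_part (T : finType) (I : eqType) (F : I -> {set T}) (s : seq I)
    (U : {set T}) :
  U != set0 -> {in U, forall x, exists2 i, i \in s & x \in F i} ->
  exists2 i, i \in s & #|U| <= size s * #|U :&: F i|.
Proof.
move=> U0 cov; apply: contrapT => no_large.
have : size s * #|U| <= size s * #|U|.-1.
  apply: leq_trans (leq_mul (leqnn _) (leq_card_cover cov)) _.
  rewrite big_distrr /= -[X in _ <= X * _]sum1_size big_distrl /=.
  rewrite big_seq [X in _ <= X]big_seq; apply: leq_sum => i si; rewrite mul1n.
  rewrite -ltnS prednK ?card_gt0 // ltnNge; apply/negP => large.
  by apply: no_large; exists i.
have /set0Pn[x /cov[i + _]] := U0; move: U0; rewrite -card_gt0.
case: s {cov no_large} => // j s U0 _.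
by rewrite leq_mul2l /= leqNgt prednK ?leqnn.
Qed.

Lemma ex_frequent_value (T : finType) (D : {set T}) n (f : 'I_n -> T) k m :
  D != set0 -> (forall i, f i \in D) -> #|D| <= m -> m * k <= n ->
  exists2 c, c \in D & k <= #|[set i | f i == c]|.
Proof.
move=> D0 fD Dm mkn; have m0 : 0 < m by apply: leq_trans Dm; rewrite card_gt0.
case: (posnP k) => [->|k0]; first by have /set0Pn[c cD] := D0; exists c.
have n0 : 0 < n by apply: leq_trans mkn; rewrite muln_gt0 m0.
have [||c] :=
  @ex_large_part _ _ (fun c => [set i | f i == c]) (enum D) [set: 'I_n].
- by rewrite -card_gt0 cardsT card_ord.
- by move=> i _; exists (f i); rewrite ?mem_enum ?inE.
rewrite mem_enum cardsT card_ord setTI -cardE => cD hc; exists c => //.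
rewrite -(leq_pmul2l m0); apply: leq_trans mkn (leq_trans hc _).
by rewrite leq_mul2r Dm orbT.
Qed.

Lemma ex_stationary (f : nat -> nat) l :
  (forall i, i < l -> f i <= f i.+1) -> 0 < f 0 -> f l <= l ->
  exists2 i, i < l & f i.+1 = f i.
Proof.
move=> f_mono f0 fl; apply: contrapT => not_stat.
have grows i : i <= l -> i < f i.
  elim: i => // i IH il; apply: leq_ltn_trans (IH (ltnW il)) _.
  rewrite ltn_neqAle f_mono // andbT eq_sym; apply/eqP => fi.
  by apply: not_stat; exists i.
by have := leq_trans (grows l (leqnn l)) fl; rewrite ltnn.
Qed.

End Pigeonhole.

Section Trips.
Variables (V : finType) (A : nat -> rel V).
Implicit Types F S X : {set V}.

(* [trip t t' x y S]: one can be at [x] just before snapshot [t], at [y] just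
   before snapshot [t'], and visit exactly [S] in between; one may wait. *)
Inductive trip : nat -> nat -> V -> V -> {set V} -> Prop :=
| trip_nil t x : trip t t x x [set x]
| trip_wait t t' x y S : trip t t' x y S -> trip t t'.+1 x y S
| trip_move t t' x y z S :
    trip t t' x y S -> A t' y z -> trip t t'.+1 x z (z |: S).

Lemma trip_end t t' x y S : trip t t' x y S -> y \in S.
Proof. by elim=> {t t' x y S} *; rewrite ?inE ?eqxx. Qed.

Lemma trip_cat t1 t2 t3 x y z S S' :
  trip t1 t2 x y S -> trip t2 t3 y z S' -> trip t1 t3 x z (S :|: S').
Proof.
move=> xy yz; elim: yz xy => {t2 t3 y z S'}.
- move=> t y xy; have /setUidPl-> // : [set y] \subset S.
  by rewrite sub1set (trip_end xy).
- by move=> t t' y z S' _ IH xy; apply/trip_wait/IH.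
- move=> t t' y z w S' _ IH zw xy; rewrite setUCA.
  by apply: trip_move zw; apply: IH.
Qed.

Lemma trip_widen t t1 t2 x y S : t1 <= t2 -> trip t t1 x y S -> trip t t2 x y S.
Proof.
move/subnKC <-; elim: (t2 - t1) => [|n IH] h; first by rewrite addn0.
by rewrite addnS; apply/trip_wait/IH.
Qed.

Lemma trip_stay t t' x : t <= t' -> trip t t' x x [set x].
Proof. by move=> tt'; apply: trip_widen tt' (trip_nil _ _). Qed.

Definition reachable t t' x y : Prop := exists S, trip t t' x y S.

Lemma reachable_refl t t' x : t <= t' -> reachable t t' x x.
Proof. by move=> h; exists [set x]; apply: trip_stay. Qed.

Lemma reachable_trans t1 t2 t3 x y z :
  reachable t1 t2 x y -> reachable t2 t3 y z -> reachable t1 t3 x z.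
Proof. by move=> [S h] [S' h']; exists (S :|: S'); apply: trip_cat h h'. Qed.

Lemma reachable_widen t t1 t2 t' x y :
  t <= t1 -> t2 <= t' -> reachable t1 t2 x y -> reachable t t' x y.
Proof.
move=> tt1 t2t' h; apply: reachable_trans (reachable_refl x tt1) _.
exact: reachable_trans h (reachable_refl y t2t').
Qed.

Lemma reachable_step t x y : A t x y -> reachable t t.+1 x y.
Proof.
by move=> h; exists (y |: [set x]); apply: trip_move h; apply: trip_nil.
Qed.

Lemma trip_detour t t1 t2 t3 t' b c X :
  reachable t t1 b c -> trip t1 t2 c c X -> t2 <= t3 -> reachable t3 t' c b ->
  exists2 S, trip t t' b b S & X \subset S.
Proof.
move=> [S1 h1] hX t23 [S2 h2].
exists (S1 :|: (X :|: ([set c] :|: S2))); last by rewrite setUCA subsetUl.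
apply: trip_cat h1 (trip_cat hX _); apply: trip_cat h2.
exact: trip_stay.
Qed.

Section Growth.
Variable Z : {set V}.

Definition grow t F : {set V} := F :|: [set y in Z | [exists x in F, A t x y]].

Lemma subset_grow t F : F \subset grow t F.
Proof. exact: subsetUl. Qed.

Lemma grow_subset t F : F \subset Z -> grow t F \subset Z.
Proof.
by move=> FZ; rewrite subUset FZ; apply/subsetP => y; rewrite inE => /andP[].
Qed.

Lemma connect_grow_fixed t F x y :
  grow t F = F -> x \in F -> connect (induced (A t) Z) x y -> y \in F.
Proof.
move=> growF xF /connectP[p]; elim: p x xF => [|z p IH] x xF /= => [_ ->//|].
move=> /andP[/and3P[_ zZ xz] pp]; apply: IH pp.
by rewrite -growF !inE zZ; apply/orP; right; apply/exists_inP; exists x.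
Qed.

Fixpoint forward t u i : {set V} :=
  if i is i'.+1 then grow (t + i') (forward t u i') else [set u].

Fixpoint backward t u i : {set V} :=
  if i is i'.+1 then grow (t - i) (backward t u i') else [set u].

Lemma forward_reachable t u i y :
  y \in forward t u i -> reachable t (t + i) u y.
Proof.
elim: i y => [|i IH] y /=.
  by rewrite inE => /eqP->; apply: reachable_refl; rewrite addn0.
rewrite !inE addnS => /orP[/IH|/andP[_ /exists_inP[x /IH h xy]]].
  exact: reachable_widen.
exact: reachable_trans h (reachable_step xy).
Qed.

Lemma backward_reachable t u i y : (forall t, symmetric (A t)) ->
  i <= t -> y \in backward t u i -> reachable (t - i) t y u.
Proof.
move=> A_sym; elim: i y => [|i IH] y it /=.
  by rewrite inE => /eqP->; apply: reachable_refl; rewrite subn0.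
rewrite !inE => /orP[/(IH _ (ltnW it))|].
  by apply: reachable_widen; rewrite ?leq_sub2l.
move=> /andP[_ /exists_inP[x /(IH _ (ltnW it)) h xy]].
apply: reachable_trans h; rewrite -(subnSK it).
by apply: reachable_step; rewrite A_sym.
Qed.

Lemma forward_subset t u i : u \in Z -> forward t u i \subset Z.
Proof.
by move=> uZ; elim: i => [|i IH]; [rewrite sub1set|apply: grow_subset].
Qed.

Lemma backward_subset t u i : u \in Z -> backward t u i \subset Z.
Proof.
by move=> uZ; elim: i => [|i IH]; [rewrite sub1set|apply: grow_subset].
Qed.

Lemma mem_forward t u i : u \in forward t u i.
Proof.
by elim: i => [|i IH]; [rewrite inE|apply: (subsetP (subset_grow _ _))].
Qed.

Lemma mem_backward t u i : u \in backward t u i.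
Proof.
by elim: i => [|i IH]; [rewrite inE|apply: (subsetP (subset_grow _ _))].
Qed.

(* The set reached from [u] since [t] grows and the set from which [u] can still
   be reached by [t + l] shrinks, so they change at most [2 #|Z|] times. *)
Lemma ex_stationary_snapshot t l u : u \in Z -> 2 * #|Z| <= l ->
  exists2 i, i < l & let F := forward t u i in
    let B := backward (t + l) u (l - i.+1) in
    grow (t + i) F = F /\ grow (t + i) B = B.
Proof.
move=> uZ Zl; pose b i := backward (t + l) u (l - i).
have b_step i : i < l -> b i = grow (t + i) (b i.+1).
  by move=> il; rewrite /b -(subnSK il) /=; congr grow; lia.
pose f i := #|forward t u i| + #|Z :\: b i|.
have f_le i : i < l -> #|forward t u i| <= #|forward t u i.+1|.
  by move=> _; apply/subset_leq_card/subset_grow.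
have b_le i : i < l -> #|Z :\: b i| <= #|Z :\: b i.+1|.
  by move=> il; apply/subset_leq_card/setDS; rewrite (b_step i) // subset_grow.
have [|||i il fi] := @ex_stationary f l.
- by move=> i il; rewrite leq_add ?f_le ?b_le.
- by rewrite addn_gt0 cards1.
- apply: leq_trans Zl; rewrite mul2n -addnn; apply: leq_add.
    exact/subset_leq_card/forward_subset.
  exact/subset_leq_card/subsetDl.
have b_card j : #|b j| + #|Z :\: b j| = #|Z|.
  by rewrite -(cardsID (b j) Z) (setIidPr _) // backward_subset.
have {}fi : #|forward t u i.+1| <= #|forward t u i| /\ #|b i| <= #|b i.+1|.
  have := f_le i il; have := b_le i il; have := b_card i; have := b_card i.+1.
  by rewrite /f in fi; clear -fi; lia.
exists i => //; split; apply/esym/eqP; rewrite eqEcard subset_grow.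
  exact: fi.1.
by rewrite -(b_step i) // fi.2.
Qed.

End Growth.
End Trips.

Definition connected_snapshots (V : finType) (A : nat -> rel V) (H : rel V) :
    Prop :=
  [/\ forall t, symmetric (A t), forall t, subrel (A t) H
    & forall t x y, connect (A t) x y].

Section Excursions.
Variables (V : finType) (A : nat -> rel V).
Implicit Types (B C D U X : {set V}) (p : {set V} * {set V}).
Implicit Types ps : seq ({set V} * {set V}).

Definition excursion D B (L q : nat) : Prop :=
  forall t U, U \subset D -> exists2 b, b \in B &
    exists2 X, trip A t (t + L) b b X & #|U| <= q * #|U :&: X|.

Lemma excursion_le D B L q L' q' : L <= L' -> q <= q' ->
  excursion D B L q -> excursion D B L' q'.
Proof.
move=> LL' qq' E t U UD; have [b bB [X hX hU]] := E t U UD; exists b => //.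
exists X; first by apply: trip_widen hX; rewrite leq_add2l.
exact: leq_trans hU (leq_mul qq' (leqnn _)).
Qed.

Lemma excursion1 c L q : 0 < q -> excursion [set c] [set c] L q.
Proof.
move=> q0 t U Uc; exists c; first exact: set11.
exists [set c]; first by apply: trip_stay; rewrite leq_addr.
by rewrite (setIidPl Uc) leq_pmull.
Qed.

(* Greedily, each round covers a [1 / q] share of what is still uncovered. *)
Lemma excursion_rounds D B L q t U r : excursion D B L q -> U \subset D ->
  exists X : V -> {set V}, {in B, forall b, trip A t (t + r * L) b b (X b)} /\
    r * #|U :\: \bigcup_(b in B) X b| <= q * #|U :&: \bigcup_(b in B) X b|.
Proof.
move=> E UD; elim: r => [|r [X [hX hU]]].
  exists (fun b => [set b]); split=> // b _.
  by rewrite mul0n addn0; apply: trip_nil.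
set cov := \bigcup_(b in B) X b in hU.
have [b bB [Y hY hUY]] :=
  E (t + r * L) (U :\: cov) (subset_trans (subsetDl _ _) UD).
pose X' a := X a :|: (if a == b then Y else [set a]); exists X'; split.
  move=> a aB; rewrite /X' mulSnr addnA; apply: trip_cat (hX a aB) _.
  by case: eqVneq => [->//|_]; apply: trip_stay; rewrite leq_addr.
set cov' := \bigcup_(a in B) X' a.
have covS : cov \subset cov'.
  apply/bigcupsP => a aB.
  exact: subset_trans (subsetUl _ _) (bigcup_sup a aB).
have Ycov' : Y \subset cov'.
  apply: subset_trans (bigcup_sup b bB); by rewrite /X' eqxx subsetUr.
have gain : #|U :&: cov| + #|(U :\: cov) :&: Y| <= #|U :&: cov'|.
  rewrite -(cardsID cov (U :&: cov')) setIDAC.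
  apply: leq_add; apply: subset_leq_card; last by rewrite setSD // setIS.
  by rewrite subsetI subsetIr setIS.
have : #|U :\: cov'| <= #|U :\: cov| by apply/subset_leq_card/setDS.
by move: hU hUY gain; clear; nia.
Qed.

Lemma excursion_repeat D B L q : B != set0 -> 0 < q -> excursion D B L q ->
  excursion D B (q * L) (2 * #|B|).
Proof.
move=> B0 q0 E t U UD; have [X [hX]] := excursion_rounds t q E UD.
set cov := \bigcup_(b in B) X b; rewrite leq_pmul2l // => half.
have {half} hU : #|U| <= 2 * #|U :&: cov|.
  by have := cardsID cov U; clear -half; lia.
case: (eqVneq (U :&: cov) set0) hU => [->|Ucov0 hU].
  rewrite cards0 muln0 leqn0 => /eqP->; have /set0Pn[b bB] := B0.
  by exists b => //; exists (X b) => //; apply: hX.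
have [x|b] := @ex_large_part _ _ X (enum B) _ Ucov0.
  by move=> /setIP[_ /bigcupP[b bB xb]]; exists b; rewrite ?mem_enum.
rewrite mem_enum -cardE => bB hb; exists b => //; exists (X b); first exact: hX.
apply: leq_trans hU _; rewrite -mulnA leq_mul2l; apply: leq_trans hb _.
by rewrite leq_mul2l subset_leq_card ?orbT // setSI // subsetIl.
Qed.

Lemma trip_cover_all s L q r :
  0 < q -> excursion [set: V] [set s] L q -> #|V| < 2 ^ r ->
  trip A 0 (r * (q * L)) s s [set: V].
Proof.
move=> q0 E Vr.
have s0 : [set s] != set0 by apply/set0Pn; exists s; apply: set11.
have {q0}E : excursion [set: V] [set s] (q * L) 2.
  by have := excursion_repeat s0 q0 E; rewrite cards1.
have [X hX hr] : exists2 X, trip A 0 (r * (q * L)) s s X &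
    2 ^ r * #|~: X| <= #|V|.
  elim: r {Vr} => [|r [X hX hr]].
    by exists [set s]; [rewrite mul0n; apply: trip_nil|rewrite mul1n max_card].
  have [_ /set1P-> [Y hY hU]] := E (0 + r * (q * L)) (~: X) (subsetT _).
  exists (X :|: Y); first by rewrite mulSnr; apply: trip_cat hX hY.
  rewrite setCU expnSr -mulnA -setDE; apply: leq_trans hr; rewrite leq_mul2l.
  by apply/orP; right; have := cardsID Y (~: X); clear -hU; lia.
suff /eqP <- : X == [set: V] by [].
rewrite -subTset -setCS setCT subset0 -cards_eq0 -leqn0 leqNgt.
by apply/negP => h; move: hr Vr h; clear; nia.
Qed.

Lemma excursion_frequent_base D B L q U (start : nat -> nat) k b n :
  U \subset D -> excursion D B L q -> #|B| <= b -> b * k <= n ->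
  exists2 c, c \in B & exists2 J : {set 'I_n}, k <= #|J| &
    {in J, forall j : 'I_n, exists2 X, trip A (start j) (start j + L) c c X &
                                #|U| <= q * #|U :&: X|}.
Proof.
move=> UD E Bb bkn.
have /choice[bX bXP] : forall j, exists bX : V * {set V},
    [/\ bX.1 \in B, trip A (start j) (start j + L) bX.1 bX.1 bX.2
      & #|U| <= q * #|U :&: bX.2|].
  by move=> j; have [c cB [X hX hU]] := E (start j) U UD; exists (c, X).
have [c cB kc] : exists2 c, c \in B & k <= #|[set j : 'I_n | (bX j).1 == c]|.
  apply: ex_frequent_value Bb bkn => [|j]; last by case: (bXP j).
  by apply/set0Pn; exists (bX 0).1; case: (bXP 0).
exists c => //; exists [set j : 'I_n | (bX j).1 == c] => // j.
rewrite inE => /eqP jc.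
by have [_ hX hU] := bXP j; exists (bX j).2; rewrite // -jc.
Qed.

Variable H : rel V.
Hypothesis AH : connected_snapshots A H.

Lemma connect_boundary C B t u :
  closed_off H C B -> B != set0 -> u \in C :|: B ->
  exists2 p, p \in B & connect (induced (A t) (C :|: B)) u p.
Proof.
have [_ A_sub A_conn] := AH.
move=> CB /set0Pn[b bB] uZ; have /connectP[p pp eb] := A_conn t u b.
rewrite {}eb in bB; elim: p u pp uZ bB => [|x p IH] u /=; first by exists u.
move=> /andP[ux pp] uZ bB; case: (boolP (u \in B)) => uB; first by exists u.
have xZ : x \in C :|: B.
  rewrite inE (negbTE uB) orbF in uZ.
  by rewrite inE; have [->|->] := CB u x uZ (A_sub _ _ _ ux); rewrite ?orbT.
have [q qB xq] := IH x pp xZ bB; exists q => //.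
by apply: connect_trans xq; apply: connect1; rewrite /induced /= uZ xZ.
Qed.

(* At a snapshot where neither the set reached from [u] nor the set from which
   [u] can be reached changes, both are unions of components of [C :|: B], and
   these contain a vertex of [B]. *)
Lemma ex_mutually_reachable C B t l u :
  closed_off H C B -> B != set0 -> u \in C :|: B -> 2 * #|C :|: B| <= l ->
  exists2 p, p \in B & reachable A t (t + l) u p /\ reachable A t (t + l) p u.
Proof.
have [A_sym _ _] := AH; move=> CB B0 uZ Zl.
have [i il [fixF fixG]] := ex_stationary_snapshot A t uZ Zl.
have [p pB up] := connect_boundary (t + i) CB B0 uZ; exists p => //; split.
  have /forward_reachable := connect_grow_fixed fixF (mem_forward _ _ _ _ _) up.
  by apply: reachable_widen; rewrite // leq_add2l ltnW.
have pG := connect_grow_fixed fixG (mem_backward _ _ _ _ _) up.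
by apply: reachable_widen (backward_reachable A_sym _ pG); lia.
Qed.

(* Pigeonhole on the vertex of [B] that is mutually reachable with [c]. *)
Lemma ex_return_vertex C B c l n (J : {set 'I_n}) (start : nat -> nat) :
  closed_off H C B -> B != set0 -> c \in C :|: B -> 2 * #|C :|: B| <= l ->
  #|B| < #|J| ->
  exists b (j j' : 'I_n), [/\ b \in B, j \in J, j' \in J, j < j' &
    reachable A (start j) (start j + l) b c /\
    reachable A (start j') (start j' + l) c b].
Proof.
move=> CB B0 cZ Zl BJ.
have /choice[f hf] (j : 'I_n) : exists b, b \in B /\
    (reachable A (start j) (start j + l) c b /\
     reachable A (start j) (start j + l) b c).
  have [b bB hb] := ex_mutually_reachable (start j) CB B0 cZ Zl.
  by exists b.
have [j [j' [jJ j'J jj' fjj']]] : exists j j' : 'I_n,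
    [/\ j \in J, j' \in J, j < j' & f j = f j'].
  apply: contrapT => no; have f_inj : {in J &, injective f}.
    move=> j j' jJ j'J fjj'; apply/val_inj.
    by case: (ltngtP j j') => // h; case: no; [exists j, j'|exists j', j].
  move: BJ; rewrite -(card_in_imset f_inj) ltnNge subset_leq_card //.
  by apply/subsetP => _ /imsetP[j _ ->]; case: (hf j).
exists (f j), j, j'; split=> //; first by case: (hf j).
by rewrite {2}fjj'; split; [case: (hf j) => _ []|case: (hf j') => _ []].
Qed.

(* The windows of length [l + L] consist of a time for travelling and a time for
   an excursion into a good piece, started at some [c] on its boundary.  Some
   [c] is used in more than [#|B|] windows; two of them pair [c] with the same
   vertex of [B], which gives a way to reach the first of these excursions and
   to come back. *)
Lemma excursion_division C B ps (k b q l L : nat) :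
  closed_off H C B -> B != set0 -> #|B| <= k -> 2 * #|C :|: B| <= l ->
  covers ps C ->
  {in ps, forall p,
    [/\ p.2 \subset C :|: B, #|p.2| <= b & excursion p.1 p.2 L q]} ->
  excursion C B (b * k.+1 * (l + L)) (size ps * q).
Proof.
move=> CB B0 Bk Zl psC psP t U UC.
case: (eqVneq U set0) => [->|U0].
  have /set0Pn[b0 b0B] := B0; exists b0 => //; exists [set b0].
    by apply: trip_stay; rewrite leq_addr.
  by rewrite cards0.
have [|p pps hp] := @ex_large_part _ _ fst ps _ U0.
  by move=> x /(subsetP UC); apply: psC.
have [pZ pb Ep] := psP p pps; pose start j := t + j * (l + L).
have [c cp [J kJ hJ]] := excursion_frequent_base (fun j => start j + l)
  (subsetIr U p.1) Ep pb (leqnn (b * k.+1)).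
have [a [j [j' [aB /hJ[X hX hUX] _ jj' [ac ca]]]]] :=
  ex_return_vertex start CB B0 (subsetP pZ c cp) Zl (leq_ltn_trans Bk kJ).
have j_ge : t <= start j by rewrite leq_addr.
have j'_le : start j' + l <= t + b * k.+1 * (l + L).
  rewrite /start -addnA leq_add2l -(leq_add2r L) -addnA -mulSnr.
  by rewrite (leq_trans _ (leq_addr _ _)) // leq_mul2r ltn_ord orbT.
have jj'_le : start j + l + L <= start j'.
  by rewrite /start -!addnA leq_add2l addnC -mulSn leq_mul2r jj' orbT.
have [S hS XS] := trip_detour (reachable_widen j_ge (leqnn _) ac) hX jj'_le
  (reachable_widen (leqnn _) j'_le ca).
exists a => //; exists S => //; apply: leq_trans hp _.
rewrite -mulnA leq_mul2l (leq_trans hUX) ?orbT // leq_mul2l.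
by rewrite subset_leq_card ?orbT // setISS // subsetIl.
Qed.

End Excursions.

Section Exploration.

Lemma scale_time_le K x X L : 0 < K -> 0 < x -> X <= L -> K <= L ->
  (K * x).+1 * (2 * K) * (K * K.+1 * (2 * (X + K) + L)) <= 40 * K ^ 4 * x * L.
Proof.
move=> K0 x0 XL KL; have Kx0 : 0 < K * x by rewrite muln_gt0 K0.
have -> : 40 * K ^ 4 * x * L = 2 * (K * x) * (2 * K) * (2 * (K * K) * (5 * L)).
  by rewrite !expnS expn0; ring.
apply: leq_mul; first by rewrite leq_mul2r; apply/orP; right; lia.
by apply: leq_mul; [nia|lia].
Qed.

Lemma smallest_scale_time_le K x : 0 < K -> 0 < x ->
  K * K.+1 * (2 * K.+1) <= 40 * K ^ 4 * x.
Proof.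
move=> K0 x0; have -> : 40 * K ^ 4 * x = K * (2 * K) * (4 * K) * (5 * K * x).
  by rewrite !expnS expn0; ring.
apply: (@leq_trans (K * (2 * K) * (4 * K))); last first.
  by rewrite leq_pmulr // !muln_gt0 K0.
by apply: leq_mul; [rewrite leq_mul2l; lia|lia].
Qed.

Variables (V : finType) (A : nat -> rel V) (H : rel V) (k : nat).
Hypotheses (AH : connected_snapshots A H) (H_sym : symmetric H).
Variable T : elimination_tree H [set: V] k.

Lemma excursion_small K (C B : {set V}) :
  closed_off H C B -> B != set0 -> #|B| <= K -> #|C| <= 1 ->
  excursion A C B (K * K.+1 * (2 * K.+1)) 1.
Proof.
move=> CB B0 BK C1; have [psB _ psC] := division_singletons H 0 0 C B.
have K0 : 0 < K by apply: leq_trans BK; rewrite card_gt0.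
have CBK := leq_trans (leq_card_setU C B).1 (leq_add C1 BK).
have E := excursion_division (l := 2 * K.+1) (L := 0) (q := 1) (b := K)
  AH CB B0 BK _ psC _.
apply: excursion_le (E _ _).
- by rewrite addn0.
- by rewrite size_map -cardE muln1.
- by rewrite leq_mul2l.
- move=> p pps; have := psB p pps; move: pps => /mapP[c _ ->] cCB.
  by rewrite cards1; split=> //; apply: excursion1.
Qed.

(* A set of size [x ^ i.+1] is divided into about [K x] pieces of size
   [x ^ i]. *)
Lemma excursion_scale (K h x i : nat) (C B : {set V}) :
  0 < x -> 3 ^ h * x <= 4 ^ h -> closed_off H C B -> B != set0 ->
  #|B| + k.+2 * h * i.+1 <= K -> #|C| <= x ^ i ->
  excursion A C B ((40 * K ^ 4 * x) ^ i.+1) (2 * K).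
Proof.
move=> x0 hx; elim: i C B => [|i IH] C B CB B0 BK Cx.
  have [BK' K0] : #|B| <= K /\ 0 < K.
    by move: B0 BK; rewrite -card_gt0; clear; lia.
  apply: excursion_le (excursion_small CB B0 BK' Cx); last by rewrite muln_gt0.
  by rewrite expn1 smallest_scale_time_le.
have [BK' BhK hK K0] :
    [/\ #|B| <= K, #|B| + k.+1 * h <= K, k.+2 * h <= K & 0 < K].
  by move: B0 BK; rewrite -card_gt0; clear; split; nia.
set L := _ ^ i.+1 in IH; have xi0 : 0 < x ^ i by rewrite expn_gt0 x0.
have hC : 3 ^ h * #|C| <= 4 ^ h * x ^ i.
  apply: leq_trans (leq_mul (leqnn _) Cx) _.
  by rewrite expnS mulnA leq_mul2r hx orbT.
have [ps [psB psP psC] ps_le] := ex_division H_sym T xi0 CB B0 hC.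
have {}ps_le : size ps <= (K * x).+1.
  rewrite -(leq_pmul2r xi0); apply: leq_trans ps_le _; rewrite mulSn leq_add2l.
  by apply: leq_trans (leq_mul hK Cx) _; rewrite expnS mulnA.
have E : excursion A C B (K * K.+1 * (2 * (x ^ i.+1 + K) + L))
    (size ps * (2 * K)).
  apply: (excursion_division AH CB B0 BK' _ psC).
    rewrite leq_mul2l.
    exact: leq_trans (leq_card_setU _ _).1 (leq_add Cx BK').
  move=> p pps; have := psB p pps.
  have [[c ->]|[pcl p0 p1 p2]] := psP p pps => pCB.
    by rewrite cards1; split=> //; apply: excursion1; rewrite muln_gt0.
  have p2K := leq_trans p2 BhK; split=> //; apply: IH => //.
  by move: BK p2; clear; nia.
have q0 : 0 < (K * x).+1 * (2 * K) by rewrite !muln_gt0.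
have {}E := excursion_le (leqnn _) (leq_mul ps_le (leqnn _)) E.
apply: excursion_le (excursion_repeat B0 q0 E); last by rewrite leq_mul2l.
rewrite [_ ^ i.+2]expnS; apply: scale_time_le => //.
  by rewrite leq_exp2r // leq_pmull // muln_gt0 expn_gt0 K0.
apply: (@leq_trans ((40 * K ^ 4 * x) ^ 1)).
  by rewrite expn1 expnS mulnCA -!mulnA leq_pmulr // !muln_gt0 K0 x0.
by rewrite /L leq_pexp2l // !muln_gt0 K0 x0.
Qed.

Lemma trip_elimination_tree (K h x i r : nat) (s : V) :
  0 < x -> 3 ^ h * x <= 4 ^ h -> 1 + k.+2 * h * i.+1 <= K -> #|V| <= x ^ i ->
  #|V| < 2 ^ r ->
  trip A 0 (r * (2 * K * (40 * K ^ 4 * x) ^ i.+1)) s s [set: V].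
Proof.
move=> x0 hx hK Vx Vr; apply: trip_cover_all => //.
  by rewrite muln_gt0; lia.
apply: excursion_scale hx _ _ _ _ => //; rewrite ?cards1 ?cardsT //.
- exact: closed_offT.
- by apply/set0Pn; exists s; apply: set11.
Qed.

End Exploration.

Section PolynomialTime.

Lemma expn_le_exp2 (d : nat) : exists c, forall l, l.+1 ^ d <= c * 2 ^ l.
Proof.
exists (d.+1 ^ d.+1) => l; apply: leq_trans (leq_pexp2l _ (leqnSn d)) _ => //.
apply: (@leq_trans ((d.+1 * 2 ^ (l %/ d.+1)) ^ d.+1)).
  rewrite leq_exp2r //; apply: (@leq_trans (d.+1 * (l %/ d.+1).+1)).
    by rewrite {1}(divn_eq l d.+1) mulnC mulnS addnC -addSn leq_add2r ltn_mod.
  by rewrite leq_mul2l ltn_expl ?orbT.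
by rewrite expnMn leq_mul2l -expnM leq_exp2l // leq_trunc_div orbT.
Qed.

Lemma ex_exp2_near y : 1 < y -> exists2 l, y <= 2 ^ l & 2 ^ l <= 2 * y.
Proof.
move=> y1; exists (up_log 2 y); first exact: up_logP.
have /andP[lt_y _] := up_log_bounds (isT : 1 < 2) y1.
by rewrite -[up_log 2 y]prednK ?up_log_gt0 // expnS leq_mul2l ltnW.
Qed.

Lemma scale_parameters (k i : nat) : exists c, forall y, 1 < y -> exists h K r,
  [/\ 3 ^ h * y ^ 3 <= 4 ^ h, 1 + k.+2 * h * i.+1 <= K, y ^ (3 * i) < 2 ^ r
    & r * (2 * K * (40 * K ^ 4 * y ^ 3) ^ i.+1) <= c * y ^ (3 * i.+1).+1].
Proof.
pose d := 4 * i.+1; pose a := k.+2 * 9 * i.+1; have [b bP] := expn_le_exp2 d.+2.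
exists (4 * 40 ^ i.+1 * (a ^ d.+2 * b)) => y y1.
have [l yl ly] := ex_exp2_near y1; pose K := (a * l).+1.
have l0 : 0 < l by case: l yl {ly K} => //; rewrite leqNgt y1.
exists (9 * l), K, (3 * i * l).+1; split.
- (* [2 ^ 3 * 3 ^ 9 <= 4 ^ 9] *)
  apply: (@leq_trans (3 ^ (9 * l) * 2 ^ (3 * l))).
    by rewrite leq_mul2l [3 * l]mulnC [2 ^ _]expnM leq_exp2r ?yl ?orbT.
  by rewrite [3 ^ _]expnM [2 ^ _]expnM [4 ^ _]expnM -expnMn leq_exp2r.
- by rewrite /K /a; lia.
- apply: (@leq_ltn_trans (2 ^ (3 * i * l))); last by rewrite ltn_exp2l.
  case: (posnP i) => [->|i0]; first by rewrite muln0 expn_gt0.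
  by rewrite [_ * l]mulnC [2 ^ _]expnM leq_exp2r // muln_gt0.
have rK : (3 * i * l).+1 <= K.
  by rewrite ltnS leq_mul2r /a; apply/orP; right; lia.
have K_le : K ^ d.+2 <= a ^ d.+2 * b * (2 * y).
  apply: (@leq_trans ((a * l.+1) ^ d.+2)).
    by rewrite leq_exp2r // mulnS /K -add1n leq_add2r /a !muln_gt0.
  rewrite expnMn -mulnA leq_mul2l; apply/orP; right.
  by apply: leq_trans (bP l) _; rewrite leq_mul2l ly orbT.
apply: leq_trans (leq_mul rK (leqnn _)) _.
have -> : K * (2 * K * (40 * K ^ 4 * y ^ 3) ^ i.+1) =
    2 * 40 ^ i.+1 * K ^ d.+2 * y ^ (3 * i.+1).
  by rewrite 2!expnMn -!expnM -/d [K ^ d.+2]expnS [K ^ d.+1]expnS; lia.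
apply: (@leq_trans (2 * 40 ^ i.+1 * (a ^ d.+2 * b * (2 * y)) * y ^ (3 * i.+1))).
  by rewrite leq_mul2r leq_mul2l K_le !orbT.
by rewrite [y ^ (3 * i.+1).+1]expnS; lia.
Qed.

Lemma trip_polynomial_time (k i : nat) : exists c,
  forall (V : finType) (A : nat -> rel V) (H : rel V),
    connected_snapshots A H -> symmetric H ->
    inhabited (elimination_tree H [set: V] k) ->
  forall y, 1 < y -> #|V| <= y ^ (3 * i) ->
  forall s, trip A 0 (c * y ^ (3 * i.+1).+1) s s [set: V].
Proof.
have [c cP] := scale_parameters k i.
exists c => V A H AH H_sym [T] y y1 Vy s.
have [h [K [r [hy hK yr time_le]]]] := cP y y1.
apply: (trip_widen time_le).
apply: (trip_elimination_tree AH H_sym T _ _ hy hK).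
- by rewrite expn_gt0 ltnW.
- by rewrite -expnM.
- exact: leq_ltn_trans Vy yr.
Qed.

End PolynomialTime.
End FiniteGraphs.

Section Distances.
Local Open Scope ring_scope.
Variables (R : realType) (E : normedModType R).

Definition dist_lt (e : R) : rel E := [rel x y | `|x - y| < e].

(* The factor 4 leaves room for moving both points by less than [e]. *)
Definition apart (e : R) : rel E := [rel x y | 4 * e <= `|x - y|].

Lemma dist_lt_sym e : symmetric (dist_lt e).
Proof. by move=> x y; rewrite /dist_lt /= distrC. Qed.

End Distances.

Section CrossingParity.
Local Open Scope ring_scope.
Variable R : realType.
Implicit Types (z w : R * R) (s f : seq (R * R)) (e : R).

Definition lex_lt z w : bool := (z.1 < w.1) || ((z.1 == w.1) && (z.2 < w.2)).

Definition higher z w : bool := w.2 < z.2.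

(* Whether the step from [z] to [z'] crosses the vertical ray above [w]; ties
   are broken by tilting the ray slightly.  Along a polygon the crossings are
   counted mod 2. *)
Definition step_above z z' w : bool :=
  (lex_lt z w (+) lex_lt z' w) && higher z w.

Definition above_step z w w' : bool :=
  (lex_lt z w (+) lex_lt z w') && higher z w.

Fixpoint chain_above z s w : bool :=
  if s is z' :: s' then step_above z z' w (+) chain_above z' s' w else false.

Fixpoint above_chain z w f : bool :=
  if f is w' :: f' then above_step z w w' (+) above_chain z w' f' else false.

Lemma lex_ltT z w : z.1 < w.1 -> lex_lt z w = true.
Proof. by rewrite /lex_lt => ->. Qed.

Lemma lex_ltF z w : w.1 < z.1 -> lex_lt z w = false.
Proof. by move=> h; rewrite /lex_lt (lt_gtF h) (gt_eqF h). Qed.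

Lemma higherT z w : w.2 < z.2 -> higher z w = true.
Proof. by []. Qed.

Lemma higherF z w : z.2 < w.2 -> higher z w = false.
Proof. exact: lt_gtF. Qed.

Lemma dist_ltE e z w : dist_lt e z w = (`|z.1 - w.1| < e) && (`|z.2 - w.2| < e).
Proof. by rewrite /dist_lt /= prod_normE gt_max. Qed.

Lemma apartE e z w :
  apart e z w = (4 * e <= `|z.1 - w.1|) || (4 * e <= `|z.2 - w.2|).
Proof. by rewrite /apart /= prod_normE le_max. Qed.

Lemma apart_comparisons e z z' w w' :
  apart e z w -> dist_lt e z z' -> dist_lt e w w' ->
  [/\ lex_lt z w = lex_lt z' w, lex_lt z w = lex_lt z w'
    & lex_lt z w = lex_lt z' w'] \/
  [/\ higher z w = higher z' w, higher z w = higher z w'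
    & higher z w = ~~ higher w z].
Proof.
rewrite apartE !dist_ltE !ltr_norml.
move=> h /andP[/andP[z1 z2] /andP[z3 z4]] /andP[/andP[w1 w2] /andP[w3 w4]].
case/orP: h; rewrite ler_normr => /orP[] h.
- by left; rewrite !lex_ltF //; lra.
- by left; rewrite !lex_ltT //; lra.
- by right; rewrite [higher w z]higherF ?higherT //; lra.
- by right; rewrite [higher w z]higherT ?higherF //; lra.
Qed.

Lemma square_parity e z z' w w' :
  apart e z w -> dist_lt e z z' -> dist_lt e w w' ->
  step_above z z' w (+) step_above z z' w' =
  above_step z w w' (+) above_step z' w w'.
Proof.
move=> zw zz' ww'; rewrite /step_above /above_step.
have [[<- <- <-]|[<- <- _]] := apart_comparisons zw zz' ww'.
  by rewrite !addbb.
move: (lex_lt z w) (lex_lt z' w) (lex_lt z w') (lex_lt z' w') (higher z w).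
by do 5 case.
Qed.

Lemma lex_lt_asym e z w : 0 < e -> apart e z w -> lex_lt z w = ~~ lex_lt w z.
Proof.
move=> e0; rewrite apartE /lex_lt; case: (ltgtP z.1 w.1) => //= ->.
case: (ltgtP z.2 w.2) => //= ->.
by rewrite !subrr normr0 orbb leNgt mulr_gt0.
Qed.

Definition apart_chains e s f : bool := all (fun z => all (apart e z) f) s.

Lemma chain_above_step e z s w w' :
  path (dist_lt e) z s -> dist_lt e w w' -> all (apart e ^~ w) (z :: s) ->
  chain_above z s w (+) chain_above z s w' =
  above_step z w w' (+) above_step (last z s) w w'.
Proof.
move=> + ww'; elim: s z => [|z' s IH] z /=; first by rewrite addbb.
move=> /andP[zz' ps] /andP[zw sw].
rewrite addbACA (IH z' ps sw) (square_parity zw zz' ww') -addbA.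
by rewrite addKb.
Qed.

Lemma chain_above_chain e z s w f :
  path (dist_lt e) z s -> path (dist_lt e) w f ->
  apart_chains e (z :: s) (w :: f) ->
  chain_above z s w (+) chain_above z s (last w f) =
  above_chain z w f (+) above_chain (last z s) w f.
Proof.
move=> ps; elim: f w => [|w' f IH] w; first by rewrite /= addbb.
move=> /andP[ww' pf] far.
have far_w : all (apart e ^~ w) (z :: s) by apply/allP => x /(allP far) /andP[].
have far_f : apart_chains e (z :: s) (w' :: f).
  by apply/allP => x /(allP far) /andP[].
rewrite /= addbACA -(IH w' pf far_f) -(chain_above_step ps ww' far_w).
by rewrite -addbA addKb.
Qed.

(* Above and below differ by how often the chain crosses the whole vertical
   line, which is determined by its end points. *)
Lemma above_chainE e z w f : 0 < e ->
  path (dist_lt e) w f -> all (apart e z) (w :: f) ->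
  above_chain z w f =
  chain_above w f z (+) (lex_lt w z (+) lex_lt (last w f) z).
Proof.
move=> e0; elim: f w => [|w' f IH] w /=; first by rewrite addbb.
move=> /andP[ww' pf] /andP[zw zf]; have zw' : apart e z w' by case/andP: zf.
have zz : dist_lt e z z by rewrite /dist_lt /= subrr normr0.
rewrite (IH w' pf zf) /above_step /step_above.
have := apart_comparisons zw zz ww'.
rewrite (lex_lt_asym e0 zw) (lex_lt_asym e0 zw').
case=> [[_ /negb_inj<- _]|[_ _ ->]]; first by rewrite !addbb.
move: (lex_lt w z) (lex_lt w' z) (lex_lt (last w' f) z) (higher w z).
by move: (chain_above w' f z); do 5 case.
Qed.

Lemma chain_parity e z s w f : 0 < e ->
  path (dist_lt e) z s -> path (dist_lt e) w f ->
  apart_chains e (z :: s) (w :: f) ->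
  chain_above z s w (+) chain_above z s (last w f) (+)
    (chain_above w f z (+) chain_above w f (last z s)) =
  lex_lt w z (+) lex_lt (last w f) z (+)
    (lex_lt w (last z s) (+) lex_lt (last w f) (last z s)).
Proof.
move=> e0 ps pf far; rewrite (chain_above_chain ps pf far).
rewrite !(above_chainE e0 pf) ?(allP far) ?mem_last ?mem_head //.
by rewrite addbACA ![_ (+) chain_above _ _ _]addbC !addKb.
Qed.

Lemma uniq_disjoint_pairs (I : eqType) (i j k l : I) :
  uniq [:: i; j; k; l] -> i != j /\ k != l.
Proof. by rewrite /= !inE !negb_or => /and4P[/and3P[ij _ _] _ kl _]. Qed.

Section CompleteGraphs.
Variables (I : eqType) (e : R) (p : I -> R * R) (chain : I -> I -> seq (R * R)).
Hypotheses (e_gt0 : 0 < e)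
  (chain_dist_lt : forall i j, i != j -> path (dist_lt e) (p i) (chain i j))
  (chain_last : forall i j, i != j -> last (p i) (chain i j) = p j)
  (chain_apart : forall i j k l, uniq [:: i; j; k; l] ->
     apart_chains e (p i :: chain i j) (p k :: chain k l)).

Definition above_edge i j k : bool := chain_above (p i) (chain i j) (p k).

Definition triangle_parity i j k : bool :=
  above_edge i j k (+) above_edge i k j (+) above_edge j k i.

Lemma edge_parity i j k l : uniq [:: i; j; k; l] ->
  above_edge i j k (+) above_edge i j l (+)
    (above_edge k l i (+) above_edge k l j) =
  lex_lt (p k) (p i) (+) lex_lt (p l) (p i) (+)
    (lex_lt (p k) (p j) (+) lex_lt (p l) (p j)).
Proof.
move=> ijkl; have [ij kl] := uniq_disjoint_pairs ijkl.
have := chain_parity e_gt0 (chain_dist_lt ij) (chain_dist_lt kl)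
  (chain_apart ijkl).
by rewrite !chain_last.
Qed.

Lemma lex_lt_asym_edges i j k l : uniq [:: i; j; k; l] ->
  lex_lt (p i) (p k) = ~~ lex_lt (p k) (p i).
Proof.
move=> /chain_apart; rewrite /apart_chains /= => /andP[/andP[ik _] _].
exact: lex_lt_asym ik.
Qed.

(* In the sum of [edge_parity] over the three pairs of opposite edges of K4 the
   comparisons of [p a] with [p b] and of [p b] with [p a] both occur for three
   pairs, and the others occur twice. *)
Lemma K4_parity i j k l : uniq [:: i; j; k; l] ->
  triangle_parity i j k (+) triangle_parity i j l (+)
    (triangle_parity i k l (+) triangle_parity j k l) = true.
Proof.
move=> ijkl; have perm_ijkl (t : seq I) :
    (forall P, count P t = count P [:: i; j; k; l]) -> uniq t.
  by move=> /permP/perm_uniq->.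
have ikjl : uniq [:: i; k; j; l] by apply: perm_ijkl => P /=; clear; lia.
have iljk : uniq [:: i; l; j; k] by apply: perm_ijkl => P /=; clear; lia.
have jk : lex_lt (p j) (p k) = ~~ lex_lt (p k) (p j).
  by apply: (@lex_lt_asym_edges j i k l); apply: perm_ijkl => P /=; clear; lia.
have jl : lex_lt (p j) (p l) = ~~ lex_lt (p l) (p j).
  by apply: (@lex_lt_asym_edges j i l k); apply: perm_ijkl => P /=; clear; lia.
have kl : lex_lt (p k) (p l) = ~~ lex_lt (p l) (p k).
  by apply: (@lex_lt_asym_edges k i l j); apply: perm_ijkl => P /=; clear; lia.
rewrite /triangle_parity (addb.[AC (3*3*(3*3))
  ((1*4*(9*12)) * (2*7*(6*11)) * (5*8*(3*10)))]).
rewrite (edge_parity ijkl) (edge_parity ikjl) (edge_parity iljk) jk jl kl.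
move: (lex_lt (p k) (p i)) (lex_lt (p l) (p i)) (lex_lt (p j) (p i)).
move: (lex_lt (p k) (p j)) (lex_lt (p l) (p j)) (lex_lt (p l) (p k)).
by do 6 case.
Qed.

(* Each of the ten triangles of K5 lies in two of its five subgraphs K4. *)
Lemma no_K5_chains (i j k l m : I) : ~~ uniq [:: i; j; k; l; m].
Proof.
apply/negP => u.
have Km := K4_parity (mask_uniq u [:: true; true; true; true; false]).
have Kl := K4_parity (mask_uniq u [:: true; true; true; false; true]).
have Kk := K4_parity (mask_uniq u [:: true; true; false; true; true]).
have Kj := K4_parity (mask_uniq u [:: true; false; true; true; true]).
have Ki := K4_parity (mask_uniq u [:: false; true; true; true; true]).
move: Ki Kj Kk Kl Km.
move: (triangle_parity i j k) (triangle_parity i j l) (triangle_parity i j m).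
move: (triangle_parity i k l) (triangle_parity i k m) (triangle_parity i l m).
move: (triangle_parity j k l) (triangle_parity j k m) (triangle_parity j l m).
by move: (triangle_parity k l m); do 10 case.
Qed.

End CompleteGraphs.
End CrossingParity.

Section Connectedness.
Local Open Scope classical_set_scope.
Local Open Scope ring_scope.

Lemma connected_locally_related (X : topologicalType) (S : set X)
    (r : X -> X -> Prop) :
  connected S -> (forall x y z, r x y -> r y z -> r x z) ->
  (forall x, S x -> \forall y \near x, S y -> r x y /\ r y x) ->
  forall x y, S x -> S y -> r x y.
Proof.
move=> cS r_trans r_near x y Sx Sy.
pose B := S `&` [set z | r x z].
suff BS : B = S by have [] : B y by rewrite BS.
apply: cS.
- by exists x; split=> //=; have /nbhs_singleton /= /(_ Sx) [] := r_near x Sx.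
- exists ([set z | S z -> r x z]°); first exact: open_interior.
  rewrite eqEsubset; split=> z [Sz].
    move=> /= rxz; split=> //; rewrite /interior /=.
    apply: filterS (r_near z Sz) => w zw Sw.
    exact: r_trans rxz (zw Sw).1.
  by move=> /nbhs_singleton /= rxz; split=> //=; apply: rxz.
- exists (~` ([set z | S z -> ~ r x z]°)).
    exact/open_closedC/open_interior.
  rewrite eqEsubset; split=> z [Sz].
    by move=> /= rxz; split=> // /nbhs_singleton /=; apply.
  move=> nz; split=> //=; apply: contrapT => nr; apply: nz.
  rewrite /interior /=; apply: filterS (r_near z Sz) => w zw Sw rxw.
  exact: nr (r_trans _ _ _ rxw (zw Sw).2).
Qed.

Variables (R : realType) (E : normedModType R).
Implicit Types (X Y K F : set E) (x y z : E).

Lemma ball_dist_lt x e y : ball x e y <-> dist_lt e x y.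
Proof. by rewrite -ball_normE. Qed.

Lemma connected_chain K e x y : 0 < e -> connected K -> K x -> K y ->
  exists s,
    [/\ path (dist_lt e) x s, last x s = y & {in x :: s, forall z, K z}].
Proof.
move=> e0 cK Kx Ky; move: x y Kx Ky.
apply: (connected_locally_related cK) => [x y z|x Kx].
- move=> [s [xs <- Ks]] [s' [ys' <- Ks']]; exists (s ++ s').
  rewrite cat_path xs ys' last_cat; split=> // w.
  rewrite -cat_cons mem_cat => /orP[/Ks//|ws']; apply: Ks'.
  by rewrite inE ws' orbT.
- apply/nbhs_ballP; exists e => //= z /ball_dist_lt xz Kz.
  split; [exists [:: z]|exists [:: x]]; rewrite /= ?xz 1?dist_lt_sym ?xz.
    by split=> // w /[!inE] /orP[] /eqP->.
  by split=> // w /[!inE] /orP[] /eqP->.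
Qed.

Lemma compact_closed_apart K F : compact K -> closed F -> K `&` F = set0 ->
  \forall e \near 0^'+, forall x y, K x -> F y -> apart e x y.
Proof.
move=> /compact_near_coveringP cK cF KF.
have : \forall e \near (0 : R)^'+,
    K `<=` [set x | forall y, F y -> apart e x y].
  apply: (cK R 0^'+ (fun e x => forall y, F y -> apart e x y)) => x Kx.
  have nFx : (~` F) x by move=> Fx; have : (K `&` F) x by []; rewrite KF.
  have /nbhs_ballP[r /= r0 rF] : nbhs x (~` F).
    by apply: open_nbhs_nbhs; split=> //; apply: closed_openC.
  exists (ball x (r / 2), [set e | e < r / 8]) => /=.
    split; first by apply: nbhsx_ballx; lra.
    by apply: nbhs_right_lt; lra.
  move=> [x' e] /= [/ball_dist_lt xx' er] y Fy.
  have : r <= `|x - y|.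
    by rewrite leNgt; apply/negP => /ball_dist_lt /rF /(_ Fy).
  have := ler_distD x' x y; move: xx'; rewrite /dist_lt /apart /=; lra.
by apply: filterS => e h x y Kx; apply: h.
Qed.

(* The connecting set is compact because this is what separates disjoint edges
   of a drawing by a positive distance. *)
Definition joined X x y : Prop :=
  exists K, [/\ compact K, connected K, K `<=` X, K x & K y].

Lemma joinedxx X x : X x -> joined X x x.
Proof.
move=> Xx; exists [set x]; split=> //; first exact: compact_set1.
  exact: connected1.
by move=> _ ->.
Qed.

Lemma joined_sym X x y : joined X x y -> joined X y x.
Proof. by move=> [K [? ? ? ? ?]]; exists K. Qed.

Lemma joined_trans X y x z : joined X x y -> joined X y z -> joined X x z.
Proof.
move=> [K [cK nK KX Kx Ky]] [L [cL nL LX Ly Lz]]; exists (K `|` L); split.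
- exact: compactU.
- by apply: connectedU => //; exists y.
- by rewrite subUset.
- by left.
- by right.
Qed.

Lemma joined_sub X Y x y : X `<=` Y -> joined X x y -> joined Y x y.
Proof.
by move=> XY [K [cK nK KX Kx Ky]]; exists K; split=> //; apply: subset_trans XY.
Qed.

Lemma joined_image X (f : R -> E) : {within `[0, 1], continuous f} ->
  f @` `[0, 1] `<=` X -> joined X (f 0) (f 1).
Proof.
move=> cf fX; exists (f @` `[0, 1]); split=> //.
- by apply: continuous_compact => //; apply: segment_compact.
- by apply: connected_continuous_connected => //; apply: segment_connected.
- by exists 0 => //=; rewrite in_itv /= lexx ler01.
- by exists 1 => //=; rewrite in_itv /= lexx ler01.
Qed.

Lemma joined_segment X x y :
  (forall t : R, 0 <= t <= 1 -> X (x + t *: (y - x))) -> joined X x y.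
Proof.
move=> hX; pose f (t : R) := x + t *: (y - x).
have f0 : f 0 = x by rewrite /f scale0r addr0.
have f1 : f 1 = y by rewrite /f scale1r subrKC.
suff : joined X (f 0) (f 1) by rewrite f0 f1.
apply: joined_image.
  apply: continuous_subspaceT => t.
  by apply: cvgD; [exact: cvg_cst|exact: scalel_continuous].
by move=> z [t /=]; rewrite in_itv /= => t01 <-; apply: hX.
Qed.

Lemma joined_ball x e y : ball x e y -> joined (ball x e) x y.
Proof.
move=> /ball_dist_lt xy; apply: joined_segment => t /andP[t0 t1].
apply/ball_dist_lt; rewrite /dist_lt /= opprD addNKr normrN normrZ.
rewrite (ger0_norm t0) distrC.
by apply: le_lt_trans xy; apply: ler_piMl.
Qed.

Lemma joined_component X x y :
  open X -> connected_component X x y -> joined X x y.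
Proof.
move=> oX xy.
have Xx : X x.
  by apply: contrapT => /connected_component_out nx; rewrite nx in xy.
apply: (connected_locally_related (@component_connected _ X x)) => //.
- by move=> u v w; apply: joined_trans.
- move=> z /connected_component_sub Xz.
  have /nbhs_ballP[e /= e0 he] : nbhs z X by apply: open_nbhs_nbhs.
  apply/nbhs_ballP; exists e => //= w zw _.
  have zw' : joined X z w := joined_sub he (joined_ball zw).
  by split=> //; apply: joined_sym.
- exact: connected_component_refl.
Qed.

End Connectedness.

Section CompleteGraphDrawings.
Local Open Scope classical_set_scope.
Local Open Scope ring_scope.
Variables (R : realType) (I : finType).
Variables (p : I -> R * R) (X : I -> I -> set (R * R)).

Lemma no_K5_drawing : (4 < #|I|)%N ->
  (forall i j, i != j -> joined (X i j) (p i) (p j)) ->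
  (forall i j k l, uniq [:: i; j; k; l] -> X i j `&` X k l = set0) -> False.
Proof.
move=> I_gt4 X_joined X_disj.
have /choice[K KP] : forall ij : I * I, exists K, ij.1 != ij.2 ->
    [/\ compact K, connected K, K `<=` X ij.1 ij.2, K (p ij.1) & K (p ij.2)].
  move=> [i j] /=; case: (eqVneq i j) => [_|/X_joined[K KP]].
    by exists set0.
  by exists K.
have K_apart : \forall e \near (0 : R)^'+, forall q : I * I * (I * I),
    uniq [:: q.1.1; q.1.2; q.2.1; q.2.2] ->
    forall x y, K q.1 x -> K q.2 y -> apart e x y.
  apply: filter_forall => -[[i j] [k l]].
  have [ijkl|/negP nu] := boolP (uniq [:: i; j; k; l]); last first.
    by apply: nearW => e u; case: nu.
  have [ij kl] := uniq_disjoint_pairs ijkl.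
  have [cK _ KX _ _] := KP (i, j) ij; have [cK' _ KX' _ _] := KP (k, l) kl.
  have clK' : closed (K (k, l)). by apply: compact_closed cK'.
  have KK' : K (i, j) `&` K (k, l) = set0.
    by rewrite -subset0 -(X_disj i j k l ijkl); apply: setISS.
  by have := compact_closed_apart cK clK' KK'; apply: filterS => e h _.
have [e [e0 {}K_apart]] := @filter_ex _ (0 : R)^'+ _ _
  (filterI (nbhs_right_gt (0 : R)) K_apart).
have /choice[c cP] : forall ij : I * I, exists s, ij.1 != ij.2 ->
    [/\ path (dist_lt e) (p ij.1) s, last (p ij.1) s = p ij.2
      & {in p ij.1 :: s, forall z, K ij z}].
  move=> [i j] /=; case: (eqVneq i j) => [_|ij]; first by exists [::].
  have [_ cK _ Ki Kj] := KP (i, j) ij.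
  by have [s sP] := connected_chain e0 cK Ki Kj; exists s.
move: I_gt4 (enum_uniq I); rewrite cardE.
case: (enum I) => [|i [|j [|k [|l [|m s]]]]] // _ /(take_uniq 5).
rewrite /= take0.
apply/negP; apply: (no_K5_chains (p := p) (chain := fun i j => c (i, j)) e0)
  => {i j k l m}i j.
- by move=> /(cP (i, j))[].
- by move=> /(cP (i, j))[].
move=> k l ijkl; have [ij kl] := uniq_disjoint_pairs ijkl.
have [_ _ cK] := cP (i, j) ij; have [_ _ cK'] := cP (k, l) kl.
apply/allP => z /cK Kz; apply/allP => w /cK' Kw.
exact: (K_apart ((i, j), (k, l))).
Qed.

End CompleteGraphDrawings.

Section Drawings.
Local Open Scope ring_scope.
Local Open Scope classical_set_scope.

Lemma compact_finite_union (X : topologicalType) (I : finType) (P : pred I)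
    (A : I -> set X) :
  (forall i, P i -> compact (A i)) -> compact [set x | exists2 i, P i & A i x].
Proof.
move=> cA; rewrite [Y in compact Y](_ : _ =
  \big[setU/set0]_(i <- enum I | P i) A i); first exact: bigsetU_compact.
rewrite -bigcup_seq_cond eqEsubset; split=> x [i /=].
  by move=> Pi Aix; exists i => //=; rewrite mem_enum.
by move=> /andP[_ Pi] Aix; exists i.
Qed.

Variable R : realType.

Lemma joined_vertical (M b : R) (z : R * R) :
  M < `|z.1| -> joined [set w : R * R | M < `|w|] z (z.1, b).
Proof.
move=> zM; apply: joined_segment => t _ /=.
by rewrite prod_normE lt_max /= subrr scaler0 addr0 zM.
Qed.

Lemma joined_horizontal (M a : R) (z : R * R) :
  M < `|z.2| -> joined [set w : R * R | M < `|w|] z (a, z.2).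
Proof.
move=> zM; apply: joined_segment => t _ /=.
by rewrite prod_normE lt_max /= subrr scaler0 addr0 zM orbT.
Qed.

Lemma joined_complement_ball (M : R) (z w : R * R) : 0 < M ->
  M < `|z| -> M < `|w| -> joined [set w : R * R | M < `|w|] z w.
Proof.
move=> M0; have MM : M < `|M + 1| by rewrite gtr0_norm; lra.
suff corner u : M < `|u| -> joined [set w : R * R | M < `|w|] u (M + 1, M + 1).
  by move=> /corner zc /corner wc; apply: joined_trans zc (joined_sym wc).
rewrite prod_normE lt_max => /orP[u1|u2].
  apply: joined_trans (joined_vertical (M + 1) u1) _.
  exact: (@joined_horizontal M _ (u.1, _)).
apply: joined_trans (joined_horizontal (M + 1) u2) _.
exact: (@joined_vertical M _ (_, u.2)).
Qed.

Variables (V : finType) (G : sgraph V) (D : plane_drawing R G).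
Implicit Types Z : {set V}.

Definition region Z : set (R * R) :=
  [set p | (exists2 x, x \in Z & p = point D x) \/
           (exists x y, [/\ x \in Z, y \in Z, adj G x y & arc D x y p])].

Lemma region_point Z x : x \in Z -> region Z (point D x).
Proof. by move=> xZ; left; exists x. Qed.

Lemma region_subset Z Z' : Z \subset Z' -> region Z `<=` region Z'.
Proof.
move=> /fintype.subsetP ZZ' p [[x xZ ->]|[x [y [xZ yZ xy h]]]].
  by left; exists x => //; apply: ZZ'.
by right; exists x, y; split=> //; apply: ZZ'.
Qed.

Lemma region_setT : region [set: V]%SET = drawn D.
Proof.
rewrite eqEsubset; split=> p.
  by case=> [[x _ ->]|[x [y [_ _ xy h]]]]; [left; exists x|right; exists x, y].
case=> [[x _ <-]|[x [y [xy h]]]]; [left; exists x|right; exists x, y];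
  by rewrite ?inE.
Qed.

Lemma region_drawn Z : region Z `<=` drawn D.
Proof.
by rewrite -region_setT; apply: region_subset; apply: finset.subsetT.
Qed.

Lemma arc_image x y : adj G x y -> exists f : R -> R * R,
  [/\ {within `[0, 1], continuous f}, f 0 = point D x, f 1 = point D y
    & arc D x y = f @` `[0, 1]].
Proof. by move=> /(arcP D)[f [? _ ? ? ?]]; exists f. Qed.

Lemma compact_region Z : compact (region Z).
Proof.
pose edge (xy : V * V) := [&& xy.1 \in Z, xy.2 \in Z & adj G xy.1 xy.2].
have -> : region Z = [set p | exists2 x, x \in Z & [set point D x] p] `|`
                     [set p | exists2 xy, edge xy & arc D xy.1 xy.2 p].
  rewrite eqEsubset; split=> p.
    case=> [[x xZ ->]|[x [y [xZ yZ xy h]]]]; first by left; exists x.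
    by right; exists (x, y); rewrite // /edge /= xZ yZ.
  case=> [[x xZ ->]|[[x y] /= /and3P[xZ yZ xy] h]]; first by left; exists x.
  by right; exists x, y.
apply: compactU; apply: compact_finite_union.
  by move=> x _; apply: compact_set1.
move=> [x y] /and3P[_ _ /arc_image[f [cf _ _ ->]]].
by apply: continuous_compact => //; apply: segment_compact.
Qed.

Lemma closed_region Z : closed (region Z).
Proof. exact: compact_closed (@compact_region Z). Qed.

Lemma region_disjoint Z Z' :
  [disjoint Z & Z']%B -> region Z `&` region Z' = set0.
Proof.
move=> /disjointFr ZZ'; have nZ x : x \in Z -> x \in Z' -> False.
  by move=> /ZZ' ->.
rewrite -subset0 => p [].
move=> [[x xZ ->]|[x [y [xZ yZ xy hp]]]]
       [[x' xZ' e]|[x' [y' [xZ' yZ' xy' hp']]]].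
- by move/point_inj: e => e; apply: (nZ x); rewrite // e.
- by have [e|e] := arc_point xy' hp'; apply: (nZ x); rewrite // e.
- rewrite e in hp; have [e'|e'] := arc_point xy hp.
    by apply: (nZ x); rewrite // -e'.
  by apply: (nZ y); rewrite // -e'.
- have xyxy' : [set x; y] <> [set x'; y'].
    move=> /seteqP[/(_ x (or_introl erefl))[] e _];
      by apply: (nZ x); rewrite // e.
  have [z [[->|->] [e|e]] _] := arc_meet xy xy' xyxy' (conj hp hp').
  + by apply: (nZ x); rewrite // e.
  + by apply: (nZ x); rewrite // e.
  + by apply: (nZ y); rewrite // e.
  + by apply: (nZ y); rewrite // e.
Qed.

Lemma joined_region Z x y : x \in Z -> connect (induced (adj G) Z) x y ->
  joined (region Z) (point D x) (point D y).
Proof.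
move=> xZ /connectP[p]; elim: p x xZ => [|z p IH] x xZ /=.
  by move=> _ ->; apply: joinedxx; apply: region_point.
move=> /andP[/and3P[_ zZ xz] pp] e; apply: joined_trans (IH z zZ pp e).
have [f [cf <- <- fE]] := arc_image xz; apply: joined_image => // w fw.
by right; exists x, z; split=> //; rewrite fE.
Qed.

Lemma outer_face_joined :
  exists p0, forall q, outer_face D q -> joined (~` drawn D) p0 q.
Proof.
have [M M0 DM] : exists2 M, 0 < M & forall z, drawn D z -> `|z| <= M.
  rewrite -region_setT.
  exact: pinfty_ex_gt0 (compact_bounded (@compact_region _)).
have outD : [set w : R * R | M < `|w|] `<=` ~` drawn D.
  by move=> z Mz /DM; rewrite leNgt Mz.
have Mc : M < `|(M + 1, M + 1) : R * R|.
  by rewrite prod_normE lt_max /= gtr0_norm; lra.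
exists (M + 1, M + 1) => q [Dq q_unbounded].
have [z qz Mz] : exists2 z, connected_component (~` drawn D) q z & M < `|z|.
  apply: contrapT => no; apply: q_unbounded; exists M; split.
    exact: num_real.
  move=> N MN z qz /=; apply: le_trans (ltW MN); rewrite leNgt.
  by apply/negP => Mz; apply: no; exists z.
apply: joined_trans (joined_sub outD (joined_complement_ball M0 Mc Mz)) _.
apply: joined_sym; apply: joined_component qz.
by rewrite -region_setT; apply/closed_openC/closed_region.
Qed.

Lemma joined_outer_face Z x p0 :
  (forall q, outer_face D q -> joined (~` drawn D) p0 q) ->
  closure (outer_face D) (point D x) -> x \notin Z ->
  joined (~` region Z) (point D x) p0.
Proof.
move=> p0J x_outer xZ.
have Zx : (~` region Z) (point D x).
  move=> Zx; have xD : [disjoint [set x]%SET & Z]%B by rewrite disjoints1.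
  have : (region [set x]%SET `&` region Z) (point D x).
    by split=> //; apply: region_point; rewrite inE.
  by rewrite region_disjoint.
have /nbhs_ballP[e /= e0 eZ] : nbhs (point D x) (~` region Z).
  by apply: open_nbhs_nbhs; split=> //; apply/closed_openC/closed_region.
have [q [q_outer xq]] : (outer_face D `&` ball (point D x) e) !=set0.
  by apply: x_outer; apply: nbhsx_ballx.
apply: joined_trans (joined_sub eZ (joined_ball xq)) _.
apply: joined_sym; apply: joined_sub (p0J q q_outer).
exact/subsetC/region_drawn.
Qed.

End Drawings.

Section OuterplanarMinors.
Local Open Scope ring_scope.
Local Open Scope classical_set_scope.

(* The fifth vertex of a K5 lies in the outer face. *)
Lemma outerplanar_K4_free (R : realType) (V : finType) (G : sgraph V) :
  outerplanar R G -> ~ complete_minor (adj G) 4 [set: V]%SET.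
Proof.
move=> [D outer] [A [_ A0 cA dA lA]].
have [p0 p0J] := outer_face_joined D.
have /choice[v vA] : forall i, exists x, x \in A i by move=> i; apply/set0Pn.
pose p oi := if oi is Some i then point D (v i) else p0.
pose X oi oj := match oi, oj with
  | Some i, Some j => region D (A i :|: A j)%SET
  | Some i, None | None, Some i => ~` region D (~: A i)%SET
  | None, None => set0
  end.
have cone i : joined (~` region D (~: A i)%SET) (point D (v i)) p0.
  by apply: joined_outer_face p0J (outer (v i)) _; rewrite !inE negbK.
have link i j : i != j -> linked (adj G) (A i) (A j).
  rewrite neq_ltn => /orP[/lA//|/lA]; apply: linkedC; exact: adj_sym.
have cone_disj i j k : i != j -> i != k ->
    ~` region D (~: A i)%SET `&` region D (A j :|: A k)%SET = set0.
  move=> ij ik; rewrite setIC -subsets_disjoint; apply: region_subset.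
  by rewrite finset.subUset -!finset.disjoints_subset !dA // eq_sym.
have link_disj i j k l : i != k -> i != l -> j != k -> j != l ->
    region D (A i :|: A j)%SET `&` region D (A k :|: A l)%SET = set0.
  move=> ik il jk jl; apply: region_disjoint.
  rewrite -finset.setI_eq0 finset.setIUl !finset.setIUr !finset.setU_eq0.
  by rewrite !finset.setI_eq0 !dA.
apply: (@no_K5_drawing R (option 'I_4) p X).
- by rewrite card_option card_ord.
- move=> [i|] [j|] //= ij; last exact: joined_sym.
  apply: joined_region; first by rewrite inE vA.
  by apply: connected_in_linked; rewrite ?vA //; apply: link.
- move=> [i|] [j|] [k|] [l|] //=; rewrite !inE ?negb_or;
    rewrite ?(inj_eq (@Some_inj _)) ?andbF //= ?andbT.
  + by move=> /and3P[/and3P[_ ik il] /andP[jk jl] _]; apply: link_disj.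
  + by move=> /andP[/andP[_ ik] jk]; rewrite setIC cone_disj // eq_sym.
  + by move=> /andP[/andP[_ il] jl]; rewrite setIC cone_disj // eq_sym.
  + by move=> /andP[/andP[ik il] _]; apply: cone_disj.
  + by move=> /andP[/andP[jk jl] _]; apply: cone_disj.
Qed.

Lemma outerplanar_elimination_tree (R : realType) (V : finType)
    (G : sgraph V) (x : V) :
  outerplanar R G -> inhabited (elimination_tree (adj G) [set: V]%SET 2).
Proof.
move=> /outerplanar_K4_free K4_free.
apply: K4_free_elimination_tree K4_free; [exact: adj_sym|exact: adj_irr|].
by apply/set0Pn; exists x; rewrite inE.
Qed.

End OuterplanarMinors.

Lemma ex_ceil_root d n : 0 < d -> 1 < n ->
  exists y, [/\ 1 < y, y.-1 ^ d < n & n <= y ^ d].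
Proof.
move=> d0 n1; have [|y yn ymin] := @ex_minnP (fun y => n <= y ^ d).
  by exists n; rewrite -{1}[n]expn1 leq_pexp2l // ltnW.
have y1 : 1 < y.
  case: y yn {ymin} => [|[|y]] //; first by rewrite exp0n // leqNgt (ltnW n1).
  by rewrite exp1n leqNgt n1.
exists y; split=> //; rewrite ltnNge; apply/negP => /ymin.
by rewrite -ltnS prednK ?ltnn // ltnW.
Qed.

Local Open Scope ring_scope.

Lemma powR_four_thirds_ge (R : realType) (n y : nat) : (1 < y)%N ->
  (y.-1 ^ 12 < n)%N -> (y%:R / 2) ^+ 16 <= n%:R `^ (4%:R / 3%:R) :> R.
Proof.
move=> y1 yn; pose b : R := n%:R `^ (3%:R^-1).
have b0 : 0 <= b by apply: powR_ge0.
have b3 : b ^+ 3 = n%:R.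
  by rewrite -powR_mulrn // -powRrM mulVf ?powRr1 // pnatr_eq0.
have -> : n%:R `^ (4%:R / 3%:R) = b ^+ 4.
  by rewrite -powR_mulrn // -powRrM mulrC.
have half0 : 0 <= (y%:R / 2 : R) by rewrite divr_ge0.
rewrite (exprM _ 4 4) lerXn2r ?nnegrE ?exprn_ge0 //.
rewrite -(@ler_pXn2r _ 3) ?nnegrE ?exprn_ge0 // b3 -exprM.
apply: (@le_trans _ _ (y.-1%:R ^+ 12)); last by rewrite -natrX ler_nat ltnW.
by rewrite lerXn2r ?nnegrE // ler_pdivrMr // -natrM ler_nat; lia.
Qed.

Lemma exploration_bound_gt (R : realType) (c : nat) : exists2 C : R, 0 < C &
  forall n y, (1 < n)%N -> (1 < y)%N -> (y.-1 ^ 12 < n)%N ->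
    (c * y ^ 16)%:R < exploration_bound C n.
Proof.
pose d : R := (ln 2) `^ (5%:R / 2%:R).
have ln2_gt0 : 0 < ln 2 :> R by rewrite ln_gt0 // ltr1n.
have d0 : 0 < d by rewrite powR_gt0.
have C0 : 0 < (c.+1 * 2 ^ 16)%:R / d.
  by rewrite divr_gt0 // ltr0n muln_gt0 expn_gt0.
exists ((c.+1 * 2 ^ 16)%:R / d) => // n y n1 y1 yn.
have d_le : d <= (ln n%:R) `^ (5%:R / 2%:R).
  apply: ge0_ler_powR; rewrite ?nnegrE ?divr_ge0 ?(ltW ln2_gt0) //.
    by rewrite ltW // ln_gt0 // ltr1n.
  by rewrite ler_ln ?posrE ?ltr0n ?ler_nat // ltnW.
have half_pow :
    (c.+1 * 2 ^ 16)%:R / d * (y%:R / 2) ^+ 16 * d = (c.+1 * y ^ 16)%:R.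
  rewrite mulrAC divfK ?gt_eqF // [LHS]mulrC 2!natrM 2!natrX mulrCA -exprMn.
  by rewrite divfK ?pnatr_eq0.
apply: (@lt_le_trans _ _ (c.+1 * y ^ 16)%:R).
  by rewrite ltr_nat ltn_mul2r expn_gt0 ltnSn (ltnW y1).
rewrite -half_pow /exploration_bound; apply: ler_pM d_le; rewrite ?(ltW d0) //.
  by rewrite mulr_ge0 ?exprn_ge0 ?divr_ge0 // ltW.
by rewrite ler_wpM2l ?(ltW C0) // powR_four_thirds_ge.
Qed.

Section TemporalWalks.
Variables (V : finType) (T : nat) (G : temporal_graph V T) (i0 : 'I_T).

(* From time [T] on, the snapshots are [G i0]. *)
Definition snapshot (t : nat) : rel V := adj (G (insubd i0 t)).

Lemma connected_snapshots_underlying :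
  always_connected G -> connected_snapshots snapshot (adj (underlying G)).
Proof.
move=> Gc; split=> t; [exact: adj_sym| |exact: Gc].
by move=> x y xy; apply/existsP; exists (insubd i0 t).
Qed.

Lemma trip_temporal_walk t t' x y (S : {set V}) :
  trip snapshot t t' x y S -> (t' <= T)%N ->
  exists w : seq (step V T),
    [/\ temporal_walk G x w, {in S, forall v, v \in visited x w},
        last x [seq a.1.2 | a : step V T <- w] = y
      & {in w, forall a : step V T, (a.2 < t')%N}].
Proof.
elim=> {t t' x y S} [t x _|t t' x y S _ IH tT|t t' x y z S _ IH yz tT].
- by exists [::]; split=> // v; rewrite !inE.
- have [w [tw vw lw wt]] := IH (ltnW tT); exists w; split=> // a /wt at'.
  exact: ltnW.
have [w [/and3P[aw sw hw] vw lw wt]] := IH (ltnW tT).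
have it' : insubd i0 t' = t' :> nat by rewrite val_insubd tT.
exists (rcons w (y, z, insubd i0 t')); split.
- apply/and3P; split; first by rewrite all_rcons aw andbT.
    case: w {vw aw hw} lw wt sw => [//|a w] /= lw wt sw.
    rewrite rcons_path sw /= /follows /= it'.
    rewrite -lw (last_map (fun a : step V T => a.1.2)) eqxx /=.
    by apply: wt; rewrite mem_last.
  by case: w {vw aw sw wt} lw hw => [/= ->|].
- move=> v; rewrite /visited map_rcons -rcons_cons mem_rcons !inE.
  by case/orP => [->//|/vw]; rewrite /visited inE => ->; rewrite orbT.
- by rewrite map_rcons last_rcons.
- move=> a; rewrite mem_rcons inE => /orP[/eqP->|/wt h]; last exact: ltnW.
  by rewrite /= it'.
Qed.

End TemporalWalks.

Theorem theorem5 (R : realType) :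
  exists2 C : R, 0 < C &
  forall (V : finType) (T : nat) (G : temporal_graph V T),
    (2 <= #|V|)%N ->
    always_connected G ->
    outerplanar R (underlying G) ->
    exploration_bound C #|V| <= T%:R ->
    forall s : V,
    exists w : seq (step V T),
      [/\ temporal_walk G s w,
          forall v : V, v \in visited s w
        & forall a : step V T, a \in w ->
            Posz (nat_of_ord a.2).+1 <= Num.ceil (exploration_bound C #|V|)].
Proof.
have [c explore] := trip_polynomial_time 2 4.
have [C C0 bound_gt] := exploration_bound_gt R c.
exists C => // V T G V2 Gc Gout CT s.
have [y [y1 yV Vy]] := ex_ceil_root (isT : 0 < 12)%N V2.
have tau_lt := bound_gt _ _ V2 y1 yV; set tau := (c * _)%N in tau_lt.
have tauT : (tau < T)%N by rewrite -(ltr_nat R) (lt_le_trans tau_lt).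
have G_snapshots := connected_snapshots_underlying (Ordinal tauT) Gc.
have tree := outerplanar_elimination_tree s Gout.
have tr := explore V _ _ G_snapshots (@adj_sym _ _) tree y y1 Vy s.
have [w [w_walk w_all _ w_lt]] := trip_temporal_walk tr (ltnW tauT).
exists w; split=> // [v|a /w_lt a_lt]; first by apply: w_all; rewrite inE.
rewrite -(ler_int R); apply: le_trans (ceil_ge _); apply: le_trans (ltW tau_lt).
by rewrite ler_nat.
Qed.
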